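(* Let $\alpha,\beta,\alpha_1,\alpha_2,x_1,x_2,p\in\mathbb{C}$ and $\lambda\in\mathbb{R}$ with $\Re(\alpha)>0$, $\Re(\beta)>0$, $\lambda\ge 0$, $|x_1|<1$, $|x_2|<1$; when $\lambda=0$ assume also $|p|<4$. Then $$\frac{1}{B(\alpha,\beta)}\int_0^1 t^{\alpha-1}(1-t)^{\beta-1}(1-x_1t)^{-\alpha_1}(1-x_2t)^{-\alpha_2}\,E_\lambda[p\,t(1-t)]\,dt$$ $$=\sum_{m,n=0}^{\infty}\frac{(\alpha)_{m+n}(\alpha_1)_m(\alpha_2)_n\,x_1^m x_2^n}{(\alpha+\beta)_{m+n}\,m!\,n!}\;{}_3\hat\Psi_2\left[\begin{array}{c}(\alpha+m+n,1),(\beta,1),(1,1);\\(\alpha+\beta+m+n,2),(1,\lambda);\end{array}\;p\right].$$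
   Context: $B(x,y)=\Gamma(x)\Gamma(y)/\Gamma(x+y)$ is the beta function and $(a)_n=\Gamma(a+n)/\Gamma(a)=a(a+1)\cdots(a+n-1)$ (with $(a)_0=1$) is the Pochhammer symbol. The Mittag-Leffler function is $E_\lambda(z)=\sum_{n=0}^\infty \frac{z^n}{\Gamma(\lambda n+1)}$ for $\lambda\ge 0$; for $\lambda=0$ it is $E_0(z)=1/(1-z)$ with $|z|<1$. The normalized Wright hypergeometric function is $${}_p\hat\Psi_q\left[\begin{array}{c}(a_1,A_1),\ldots,(a_p,A_p);\\(b_1,B_1),\ldots,(b_q,B_q);\end{array}z\right]=\sum_{k=0}^\infty\frac{\prod_{j=1}^p\Gamma(a_j+A_jk)/\Gamma(a_j)}{\prod_{j=1}^q\Gamma(b_j+B_jk)/\Gamma(b_j)}\,\frac{z^k}{k!}$$ (a parameter pair $(1,0)$ contributes the factor $1$). Complex powers $(1-x_it)^{-\alpha_i}$ are principal values. *)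

(* Defs.v *)
(* MathComp-Analysis, with complex numbers R[i] over an arbitrary realType R. *)
From HB Require Import structures.
From mathcomp Require Import all_boot all_order all_algebra finmap.
From mathcomp Require Import all_classical all_reals all_analysis.
From mathcomp Require Import complex.

Set Implicit Arguments.
Unset Strict Implicit.
Unset Printing Implicit Defensive.

Import Order.TTheory GRing.Theory Num.Theory.
Import numFieldNormedType.Exports.

Local Open Scope classical_set_scope.
Local Open Scope complex_scope.
Local Open Scope ring_scope.

Section ComplexPower.
Context {R : realType}.
Implicit Types z w a : R[i].

Definition cexp z : R[i] :=
  (expR (complex.Re z))%:C * (cos (complex.Im z) +i* sin (complex.Im z)).

(* Principal argument, with values in ]-pi, pi]; only meant for z != 0. *)
Definition carg z : R :=
  let theta := acos (complex.Re z / Normc.normc z) in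
  if 0 <= complex.Im z then theta else - theta.

Definition clog z : R[i] := ln (Normc.normc z) +i* carg z.

(* Principal value of z ^ a. *)
Definition cpow z a : R[i] :=
  if z == 0 then (a == 0)%:R else cexp (a * clog z).

End ComplexPower.

Section ComplexIntegralAndSums.
Context {R : realType}.

(* Lebesgue integral over D of a complex-valued function of a real variable. *)
Definition cintegrable (D : set R) (f : R -> R[i]) : Prop :=
  lebesgue_measure.-integrable D (EFin \o (fun t => complex.Re (f t))) /\
  lebesgue_measure.-integrable D (EFin \o (fun t => complex.Im (f t))).

Definition cintegral (D : set R) (f : R -> R[i]) : R[i] :=
  (\int[lebesgue_measure]_(t in D) complex.Re (f t))%R +i*
  (\int[lebesgue_measure]_(t in D) complex.Im (f t))%R.

(* R[i]^o is R[i] with the topology of its modulus. *)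
Definition ccvg_series (u : nat -> R[i]) : Prop :=
  cvgn (series (u : nat -> R[i]^o)).

Definition cseries (u : nat -> R[i]) : R[i] :=
  limn (series (u : nat -> R[i]^o)).

(* Unconditional summation: the net of sums over finite subsets of I, ordered
   by inclusion, converges to s. *)
Definition has_csum (I : choiceType) (f : I -> R[i]) (s : R[i]) : Prop :=
  forall e : R, 0 < e ->
    exists A : {fset I}, forall B : {fset I}, (A `<=` B)%fset ->
      `|\sum_(i <- B) f i - s| < e%:C.

End ComplexIntegralAndSums.

Section SpecialFunctions.
Context {R : realType}.
Implicit Types z a b x y : R[i].

Definition pochhammer a (n : nat) : R[i] := \prod_(i < n) (a + i%:R).

Definition euler_gamma z : R[i] :=
  cintegral `]0, +oo[ (fun t => cpow t%:C (z - 1) * (expR (- t))%:C).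

(* Euler's integral when 0 < Re z, extended to Re z <= 0 by the functional
   equation Gamma z = Gamma (z + n) / (z)_n, with n such that 0 < Re (z + n);
   the value at the poles is the conventional 0. *)
Definition Gamma z : R[i] :=
  if 0 < complex.Re z then euler_gamma z
  else let n := (Num.truncn (- complex.Re z)).+1 in
       euler_gamma (z + n%:R) / pochhammer z n.

Definition Beta x y : R[i] := Gamma x * Gamma y / Gamma (x + y).

(* For lambda = 0 this is the geometric series, of sum 1 / (1 - z) on the
   unit disc. *)
Definition mittag_leffler (lambda : R) z : R[i] :=
  cseries (fun n => z ^+ n / Gamma (lambda * n%:R + 1)%:C).

(* The upper parameters (a_j, A_j) and the lower ones (b_j, B_j) are listed
   in s and t. *)
Definition wright_coef (s : seq (R[i] * R)) (k : nat) : R[i] :=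
  \prod_(c <- s) (Gamma (c.1 + (c.2 * k%:R)%:C) / Gamma c.1).

Definition wright_term (s t : seq (R[i] * R)) z (k : nat) : R[i] :=
  wright_coef s k / wright_coef t k * (z ^+ k / k`!%:R).

Definition wright_hat (s t : seq (R[i] * R)) z : R[i] :=
  cseries (wright_term s t z).

End SpecialFunctions.

(* Main.v *)
Require Import Defs.
From HB Require Import structures.
From mathcomp Require Import all_boot all_order all_algebra finmap.
From mathcomp Require Import all_classical all_reals all_analysis.
From mathcomp Require Import measurable_realfun complex ring lra zify.

(** Expand the three factors of the integrand other than the Beta weight
    [t^(alpha-1) (1-t)^(beta-1)] into power series and integrate termwise.
    The term of index [(m, n, k)] is a constant times the Beta integral
    [Bint (alpha+m+n+k) (beta+k)], and by the recurrences of the Beta integral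
    ([BintDn]) its quotient by [Bint alpha beta] is the ratio of Pochhammer
    symbols that occurs in the double series and in the Wright series.

    The interchange of sums and integral rests on uniform estimates only.  The
    coefficients of the two binomial series are bounded by [C * q ^ k] with
    [q < 1] ([binom_coef_geometric]), and so are the coefficients of the
    Mittag-Leffler series multiplied by [4 ^ - k], which is what matters since
    [0 < t (1-t) <= 1/4] on the interval ([mlcoef_geometric]); for
    [lambda = 0] this is where [`|p| < 4] enters, and for [lambda > 0] it
    holds because [Gamma] grows faster than any exponential
    ([Gamma_real_lb]).  Hence partial sums approximate the factors uniformly
    in [t], and the weight is integrable.  Integrating the Mittag-Leffler
    series gives the inner Wright series ([wright_hatE]); the product of the
    two binomial series is then approximated by the sum over any finite set of
    indices that contains a large square ([product_sum_dist]), which gives the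
    unconditional summation ([double_series]).

    Three classical facts feed this argument.

    - The binomial series [binomial_series].  Its partial sums almost satisfy
      the differential equation of [(1 - x t)^(-a)], with a defect that tends
      to zero uniformly; multiplying by [(1 - x t)^a] and applying the mean
      value theorem gives the sum without differentiating an infinite series.

    - [Gamma a != 0] for [0 < Re a], without which the quotients of Gamma
      values in the statement would be meaningless ([Gamma_neq0]).

    - The Beta integral equals [Gamma a * Gamma b / Gamma (a + b)] ([BetaE]).

    The last two follow together from a concentration argument.  After the
    scaling [t = (n+1) u] the weight [t^n e^(-t)] concentrates at [u = 1], so
    [Gamma (a + n + 1)] is equivalent to [n! (n+1)^a] ([Gamma_asymp]);
    likewise [t^n (1-t)^n] concentrates at [t = 1/2] ([Bint_asymp]).  In the
    quotient of [Bint a b * Gamma (a + b)] by [Gamma a * Gamma b] the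
    recurrences allow to shift both arguments by [n + 1] without changing its
    value, and the two equivalents show that it is 1. *)

Set Implicit Arguments.
Unset Strict Implicit.
Unset Printing Implicit Defensive.

Import Order.TTheory GRing.Theory Num.Theory.
Import numFieldNormedType.Exports.

Local Open Scope classical_set_scope.
Local Open Scope complex_scope.
Local Open Scope ring_scope.

Local Notation normc := Normc.normc.
Local Notation Re := complex.Re.
Local Notation Im := complex.Im.

(** * Complex numbers and complex powers of positive reals *)
Section ComplexBasics.
Context {R : realType}.
Implicit Types (z w a : R[i]) (t : R).

Lemma normr_normc z : `|z| = (normc z)%:C.
Proof. by []. Qed.

Lemma normc_ge0 z : 0 <= normc z.
Proof. by rewrite -lecR -normr_normc normr_ge0. Qed.

Lemma normc_eq0 z : (normc z == 0) = (z == 0).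
Proof.
by apply/eqP/eqP => [/Normc.eq0_normc//|->]; rewrite Normc.normc0.
Qed.

Lemma normc_real (t : R) : normc t%:C = `|t|.
Proof. by rewrite /= expr0n addr0 sqrtr_sqr. Qed.

Lemma normc_ge0_real (t : R) : 0 <= t -> normc t%:C = t.
Proof. by move=> t0; rewrite normc_real ger0_norm. Qed.

Lemma natC (n : nat) : (n%:R : R[i]) = (n%:R : R)%:C.
Proof. by rewrite rmorph_nat. Qed.

Lemma normc_nat (n : nat) : normc (n%:R : R[i]) = n%:R.
Proof. by rewrite natC normc_ge0_real. Qed.

Lemma normc1 : normc (1 : R[i]) = 1.
Proof. exact: Normc.normc1. Qed.

Lemma normc0 : normc (0 : R[i]) = 0.
Proof. exact: Normc.normc0. Qed.

Lemma normcX z n : normc (z ^+ n) = normc z ^+ n.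
Proof.
by elim: n => [|n IH]; rewrite ?expr0 ?normc1// !exprS Normc.normcM IH.
Qed.

Lemma ler_normcD z w : normc (z + w) <= normc z + normc w.
Proof. exact: le_normcD. Qed.

Lemma normcB z w : normc (z - w) = normc (w - z).
Proof. by rewrite -opprB normcN. Qed.

Lemma ler_normcB z w : normc (z - w) <= normc z + normc w.
Proof. by rewrite (le_trans (ler_normcD _ _))// normcN. Qed.

Lemma ler_norm_Re z : `|Re z| <= normc z.
Proof.
by case: z => x y /=; rewrite -sqrtr_sqr ler_sqrt ?addr_ge0 ?sqr_ge0// lerDl sqr_ge0.
Qed.

Lemma ler_norm_Im z : `|Im z| <= normc z.
Proof.
by case: z => x y /=; rewrite -sqrtr_sqr ler_sqrt ?addr_ge0 ?sqr_ge0// lerDr sqr_ge0.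
Qed.

Lemma ler_normc_ReIm z : normc z <= `|Re z| + `|Im z|.
Proof.
case: z => x y /=; rewrite -(ger0_norm (_ : 0 <= `|x| + `|y|)) ?addr_ge0//.
rewrite -sqrtr_sqr ler_sqrt ?sqr_ge0// sqrrD !real_normK ?num_real//.
by rewrite lerD2r lerDl mulrn_wge0// mulr_ge0.
Qed.

Lemma ler_normc_sum (I : Type) (r : seq I) (P : pred I) (F : I -> R[i]) :
  normc (\sum_(i <- r | P i) F i) <= \sum_(i <- r | P i) normc (F i).
Proof.
elim/big_rec2 : _ => [|i y x _ le]; first by rewrite normc0.
by rewrite (le_trans (ler_normcD _ _))// lerD2l.
Qed.

Lemma cReD z w : Re (z + w) = Re z + Re w. Proof. by case: z; case: w. Qed.
Lemma cImD z w : Im (z + w) = Im z + Im w. Proof. by case: z; case: w. Qed.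
Lemma cReN z : Re (- z) = - Re z. Proof. by case: z. Qed.
Lemma cImN z : Im (- z) = - Im z. Proof. by case: z. Qed.
Lemma cReM z w : Re (z * w) = Re z * Re w - Im z * Im w.
Proof. by case: z => ? ?; case: w. Qed.
Lemma cImM z w : Im (z * w) = Re z * Im w + Im z * Re w.
Proof. by case: z => ? ?; case: w => ? ?. Qed.
Lemma cReMn_nat (n : nat) : Re (n%:R : R[i]) = n%:R.
Proof. by rewrite natC. Qed.
Lemma complexP z w : Re z = Re w -> Im z = Im w -> z = w.
Proof. by case: z => ? ?; case: w => ? ? /= -> ->. Qed.

Lemma cexpD z w : cexp (z + w) = cexp z * cexp w.
Proof.
rewrite /cexp; case: z => a b; case: w => c d /=.
rewrite expRD cosD sinD.
by apply: complexP; rewrite !(cReM, cImM) /=; ring.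
Qed.

Lemma cexp0 : cexp (0 : R[i]) = 1.
Proof. by rewrite /cexp /= expR0 cos0 sin0 mul1r. Qed.

Lemma normc_cexp z : normc (cexp z) = expR (Re z).
Proof.
rewrite /cexp Normc.normcM normc_ge0_real ?expR_ge0//=.
by rewrite cos2Dsin2 sqrtr1 mulr1.
Qed.

Lemma cexp_neq0 z : cexp z != 0.
Proof. by rewrite -normc_eq0 normc_cexp expR_eq0. Qed.

Lemma cexpN z : cexp (- z) = (cexp z)^-1.
Proof.
by apply: (mulfI (cexp_neq0 z)); rewrite -cexpD subrr cexp0 divff// cexp_neq0.
Qed.

Lemma cexp_real t : cexp t%:C = (expR t)%:C.
Proof. by rewrite /cexp /= cos0 sin0 mulr1. Qed.

Lemma cexpM_nat n z : cexp (n%:R * z) = cexp z ^+ n.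
Proof.
elim: n => [|n IH]; first by rewrite mul0r cexp0 expr0.
by rewrite -natr1 mulrDl mul1r cexpD IH exprSr.
Qed.

Lemma clog_pos t : 0 < t -> clog t%:C = (ln t)%:C.
Proof.
move=> t0; have tE := normc_ge0_real (ltW t0).
by rewrite /clog /carg tE /= lexx divff ?gt_eqF// acos1.
Qed.

Lemma cpow_pos t a : 0 < t -> cpow t%:C a = cexp (a * (ln t)%:C).
Proof.
by move=> t0; rewrite /cpow (inj_eq (@complexI _)) gt_eqF// clog_pos.
Qed.

Lemma cpow_neq0 t a : 0 < t -> cpow t%:C a != 0.
Proof. by move=> /cpow_pos ->; exact: cexp_neq0. Qed.

Lemma cpowD t a w : 0 < t -> cpow t%:C (a + w) = cpow t%:C a * cpow t%:C w.
Proof. by move=> t0; rewrite !cpow_pos// mulrDl cexpD. Qed.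

Lemma cpow_nat t n : 0 < t -> cpow t%:C n%:R = t%:C ^+ n.
Proof. by move=> t0; rewrite cpow_pos// cexpM_nat cexp_real lnK. Qed.

Lemma cpowDn t a n : 0 < t -> cpow t%:C (a + n%:R) = cpow t%:C a * t%:C ^+ n.
Proof. by move=> t0; rewrite cpowD// cpow_nat. Qed.

Lemma cpowM s t a : 0 < s -> 0 < t -> cpow (s * t)%:C a = cpow s%:C a * cpow t%:C a.
Proof.
move=> s0 t0; rewrite !cpow_pos ?mulr_gt0// lnM ?posrE// -cexpD.
by rewrite rmorphD/= mulrDr.
Qed.

Lemma normc_cpow t a : 0 < t -> normc (cpow t%:C a) = t `^ (Re a).
Proof.
by move=> t0; rewrite cpow_pos// normc_cexp /powR gt_eqF// cReM /= mulr0 subr0.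
Qed.

End ComplexBasics.

(** * Complex-valued functions of a real variable: derivatives *)
Section ComplexDerivative.
Context {R : realType}.
Implicit Types (f g : R -> R[i]) (t : R) (c : R[i]).

(** The derivative is taken componentwise, so that the rules for real
    functions apply to each component. *)
Definition is_cderive f t (d : R[i]) : Prop :=
  is_derive t 1 (fun s => Re (f s)) (Re d) /\
  is_derive t 1 (fun s => Im (f s)) (Im d).

Lemma is_cderiveE f g t d e : is_cderive f t d -> f =1 g -> d = e ->
  is_cderive g t e.
Proof. by move=> + /funext <- <-. Qed.

Lemma is_cderive_cst c t : is_cderive (fun=> c) t 0.
Proof. by split; exact: is_derive_cst. Qed.

Lemma is_cderive_real (f : R -> R) t d :
  is_derive t 1 f d -> is_cderive (fun s => (f s)%:C) t d%:C.
Proof. by split => //=; exact: is_derive_cst. Qed.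

Lemma is_cderiveD f g t d e : is_cderive f t d -> is_cderive g t e ->
  is_cderive (fun s => f s + g s) t (d + e).
Proof.
move=> [f1 f2] [g1 g2]; split.
- rewrite cReD (_ : (fun _ => _) = (fun s => Re (f s)) + (fun s => Re (g s))).
    exact: is_deriveD.
  by apply/funext => s; rewrite cReD.
- rewrite cImD (_ : (fun _ => _) = (fun s => Im (f s)) + (fun s => Im (g s))).
    exact: is_deriveD.
  by apply/funext => s; rewrite cImD.
Qed.

Lemma is_cderiveM f g t d e : is_cderive f t d -> is_cderive g t e ->
  is_cderive (fun s => f s * g s) t (d * g t + f t * e).
Proof.
move=> [f1 f2] [g1 g2]; split.
- rewrite (_ : (fun _ => _) = (fun s => Re (f s)) * (fun s => Re (g s))
     - (fun s => Im (f s)) * (fun s => Im (g s))).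
    apply: is_derive_eq; rewrite !(cReD, cReM, cImM, cReN) /= /GRing.scale/=; ring.
  by apply/funext => s; rewrite cReM.
- rewrite (_ : (fun _ => _) = (fun s => Re (f s)) * (fun s => Im (g s))
     + (fun s => Im (f s)) * (fun s => Re (g s))).
    apply: is_derive_eq; rewrite !(cImD, cReM, cImM, cReN) /= /GRing.scale/=; ring.
  by apply/funext => s; rewrite cImM.
Qed.

Lemma is_cderiveZ c f t d : is_cderive f t d -> is_cderive (fun s => c * f s) t (c * d).
Proof.
move=> fd; apply: (is_cderiveE (is_cderiveM (is_cderive_cst c t) fd)) => //.
by rewrite mul0r add0r.
Qed.

Lemma is_cderive_sum (f_ : nat -> R -> R[i]) (d_ : nat -> R[i]) t n :
  (forall i, (i < n)%N -> is_cderive (f_ i) t (d_ i)) ->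
  is_cderive (fun s => \sum_(i < n) f_ i s) t (\sum_(i < n) d_ i).
Proof.
elim: n => [|n IH] H.
  by apply: (is_cderiveE (is_cderive_cst 0 t)) => [s|]; rewrite big_ord0.
have /is_cderiveD : is_cderive (fun s => \sum_(i < n) f_ i s) t (\sum_(i < n) d_ i).
  by apply: IH => i iltn; apply: H; rewrite (ltn_trans iltn).
move=> /(_ _ _ (H n (ltnSn n))) K.
by apply: (is_cderiveE K) => [s|]; rewrite big_ord_recr.
Qed.

Lemma is_cderiveX f t d n : is_cderive f t d ->
  is_cderive (fun s => f s ^+ n) t (n%:R * f t ^+ n.-1 * d).
Proof.
move=> fd; elim: n => [|n IH].
  by apply: (is_cderiveE (is_cderive_cst 1 t)) => //; rewrite !mul0r.
apply: (is_cderiveE (is_cderiveM fd IH)) => [s|]; first by rewrite exprS.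
case: n {IH} => [|n] /=; first by rewrite !expr0; ring.
by rewrite -(@natr1 _ n.+1) exprS; ring.
Qed.

Lemma is_cderive_cexp f t d : is_cderive f t d ->
  is_cderive (fun s => cexp (f s)) t (d * cexp (f t)).
Proof.
move=> [f1 f2]; split; rewrite /cexp.
- rewrite (_ : (fun _ => _) = (expR \o (fun s => Re (f s))) *
     (cos \o (fun s => Im (f s)))); last first.
    by apply/funext => s; rewrite cReM /= mul0r subr0.
  by apply: is_derive_eq; rewrite !(cReM, cImM) /= /GRing.scale/=; ring.
- rewrite (_ : (fun _ => _) = (expR \o (fun s => Re (f s))) *
     (sin \o (fun s => Im (f s)))); last first.
    by apply/funext => s; rewrite cImM /= mul0r addr0.
  by apply: is_derive_eq; rewrite !(cReM, cImM) /= /GRing.scale/=; ring.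
Qed.

End ComplexDerivative.

Local Notation mu := (@lebesgue_measure _).

(** * The fundamental theorem of calculus on open intervals *)
Section ImproperFTC.
Context {R : realType}.
Variables (D : set R) (a_ b_ : nat -> R).
Hypotheses (ab : forall n, a_ n < b_ n) (a_dec : nonincreasing_seq a_)
  (b_inc : nondecreasing_seq b_) (DE : D = \bigcup_n `[a_ n, b_ n]%classic).
Variables (F f : R -> R).
Hypotheses (cf : forall t, D t -> {for t, continuous f})
  (dF : forall t, D t -> is_derive t 1 F (f t)).

Let sub_D n : `[a_ n, b_ n] `<=` D.
Proof. by rewrite DE => t nt; exists n. Qed.

Let mD : measurable D.
Proof. by rewrite DE; apply: bigcup_measurable => n _; exact: measurable_itv. Qed.

Lemma within_compact_continuous n : {within `[a_ n, b_ n], continuous f}.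
Proof. by apply/continuous_in_subspaceT => t; rewrite inE => /sub_D /cf. Qed.

Lemma measurable_on_exhaustion : measurable_fun D f.
Proof.
rewrite DE; apply/measurable_fun_bigcup => [n|n]; first exact: measurable_itv.
apply: subspace_continuous_measurable_fun; first exact: measurable_itv.
exact: within_compact_continuous.
Qed.

Lemma FTC_compact n :
  (\int[mu]_(x in `[a_ n, b_ n]) (f x)%:E = (F (b_ n) - F (a_ n))%:E)%E.
Proof.
have cF t : D t -> {for t, continuous F}.
  move=> Dt; apply: differentiable_continuous; apply/derivable1_diffP.
  by have [] := dF Dt.
rewrite EFinB; apply: continuous_FTC2 => //.
- exact: within_compact_continuous.
- split=> [t tab| |].
  + by have [] := dF (sub_D (subset_itv_oo_cc tab)).
  + by apply: cvg_at_right_filter; apply: cF; apply: (sub_D (n := n)); rewrite /= in_itv/= lexx ltW.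
  + by apply: cvg_at_left_filter; apply: cF; apply: (sub_D (n := n)); rewrite /= in_itv/= lexx ltW.
- move=> t tab; rewrite derive1E; apply: derive_val.
  exact: dF (sub_D (subset_itv_oo_cc tab)).
Qed.

Let nd : nondecreasing_seq (fun n => `[a_ n, b_ n]%classic).
Proof.
move=> m n mn; rewrite subsetEset => t /=; rewrite !in_itv/= => /andP[at_ tb].
by rewrite (le_trans (a_dec mn) at_) (le_trans tb (b_inc mn)).
Qed.

(** Monotone convergence along the exhaustion: the integrals over the compact
    intervals are the increments of [F]. *)
Lemma integrable_improper_FTC M : (forall t, D t -> 0 <= f t) ->
  (forall n, F (b_ n) - F (a_ n) <= M) -> mu.-integrable D (EFin \o f).
Proof.
move=> f0 FM; apply/integrableP; split.
  by apply/measurable_EFinP; exact: measurable_on_exhaustion.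
apply: (@le_lt_trans _ _ M%:E); last by rewrite ltry.
rewrite (@eq_integral _ _ _ (@lebesgue_measure R) D (EFin \o f)); last first.
  by move=> t /set_mem Dt /=; rewrite ger0_norm// f0.
have mf n : measurable_fun `[a_ n, b_ n] (EFin \o f).
  apply/measurable_EFinP; exact: measurable_funS measurable_on_exhaustion.
have H := @ge0_nondecreasing_set_cvg_integral _ (measurableTypeR R) R
  (fun n => `[a_ n, b_ n]%classic) (EFin \o f) mu nd
  (fun=> measurable_itv _) mf.
rewrite DE; apply: (cvge_le _ (H _)).
  by apply: nearW => n; rewrite FTC_compact lee_fin.
by move=> n t /sub_D Dt; rewrite lee_fin f0.
Qed.

(** Dominated convergence along the exhaustion, with [`|f|] as the bound. *)
Lemma improper_FTC l : mu.-integrable D (EFin \o f) ->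
  F (b_ n) - F (a_ n) @[n --> \oo] --> l -> (\int[mu]_(t in D) f t)%R = l.
Proof.
move=> fi Fl.
have mf := measurable_on_exhaustion.
pose f_ n := (EFin \o f) \_ `[a_ n, b_ n].
have H : (\int[mu]_(x in D) f_ n x @[n --> \oo] --> \int[mu]_(x in D) (f x)%:E)%E.
  apply: (@dominated_cvg _ _ _ mu D mD f_ (EFin \o f) (abse \o (EFin \o f))) => //.
  - move=> n; apply: (measurable_funS measurableT) => //.
    apply/(measurable_restrictT _ (measurable_itv _)).
    by apply/measurable_EFinP; exact: measurable_funS mf.
  - move=> t; rewrite DE => -[k _ kt]; apply: cvg_near_cst.
    exists k => // n /= kn; rewrite /f_ patchE mem_set//.
    by have := nd kn; rewrite subsetEset; apply.
  - exact: integrable_abse.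
  - move=> n t _; rewrite /f_ patchE; case: ifPn => // _.
    by rewrite abse0 abse_ge0.
have E n : (\int[mu]_(x in D) f_ n x)%E = (F (b_ n) - F (a_ n))%:E.
  rewrite /f_ -integral_mkcondr (_ : D `&` _ = `[a_ n, b_ n]%classic).
    exact: FTC_compact.
  by rewrite setIC; apply/setIidPl.
rewrite /Rintegral; move: H; under eq_fun do rewrite E.
move=> /cvg_lim <-//.
have : ((F (b_ n) - F (a_ n))%:E @[n --> \oo] --> l%:E)%E.
  by apply: cvg_EFin => //; exact: nearW.
by move=> /cvg_lim ->.
Qed.

End ImproperFTC.

(** * Integrals of complex-valued functions *)
Section ComplexIntegral.
Context {R : realType}.
Implicit Types (D : set R) (f g : R -> R[i]) (h : R -> R) (c : R[i]).

Definition cmeasurable D f :=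
  measurable_fun D (fun t => Re (f t)) /\ measurable_fun D (fun t => Im (f t)).

Lemma cmeasurable_eq D f g : (forall t, D t -> f t = g t) ->
  cmeasurable D f -> cmeasurable D g.
Proof.
move=> fg [f1 f2]; split.
- by apply: eq_measurable_fun f1 => t /set_mem /fg ->.
- by apply: eq_measurable_fun f2 => t /set_mem /fg ->.
Qed.

Lemma cmeasurable_cst D c : cmeasurable D (fun=> c).
Proof. by split; exact: measurable_cst. Qed.

Lemma cmeasurable_real D h : measurable_fun D h -> cmeasurable D (fun t => (h t)%:C).
Proof. by split => //=; exact: measurable_cst. Qed.

Lemma cmeasurableD D f g : cmeasurable D f -> cmeasurable D g ->
  cmeasurable D (fun t => f t + g t).
Proof.
move=> [f1 f2] [g1 g2]; split.
- by under eq_fun do rewrite cReD; exact: measurable_funD.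
- by under eq_fun do rewrite cImD; exact: measurable_funD.
Qed.

Lemma cmeasurableM D f g : cmeasurable D f -> cmeasurable D g ->
  cmeasurable D (fun t => f t * g t).
Proof.
move=> [f1 f2] [g1 g2]; split.
- rewrite (_ : (fun t => _) =
    (fun t => Re (f t) * Re (g t)) \- (fun t => Im (f t) * Im (g t))).
    by apply: measurable_funB; exact: measurable_funM.
  by apply/funext => t /=; rewrite cReM.
- rewrite (_ : (fun t => _) =
    (fun t => Re (f t) * Im (g t)) \+ (fun t => Im (f t) * Re (g t))).
    by apply: measurable_funD; exact: measurable_funM.
  by apply/funext => t /=; rewrite cImM.
Qed.

Lemma cmeasurableX D f n : cmeasurable D f -> cmeasurable D (fun t => f t ^+ n).
Proof.
move=> mf; elim: n => [|n IH]; first exact: cmeasurable_cst.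
by under eq_fun do rewrite exprS; exact: cmeasurableM.
Qed.

Lemma cmeasurable_sum D (I : Type) (r : seq I) (F : I -> R -> R[i]) :
  (forall i, cmeasurable D (F i)) ->
  cmeasurable D (fun t => \sum_(i <- r) F i t).
Proof.
move=> mF; elim: r => [|i r IH].
  by under eq_fun do rewrite big_nil; exact: cmeasurable_cst.
by under eq_fun do rewrite big_cons; exact: cmeasurableD.
Qed.

Lemma cmeasurable_cexp D f : cmeasurable D f -> cmeasurable D (fun t => cexp (f t)).
Proof.
move=> [f1 f2]; apply: cmeasurableM.
  by apply: cmeasurable_real; exact: (measurableT_comp (@measurable_expR R)).
split => /=.
- exact: (measurableT_comp (continuous_measurable_fun (@continuous_cos R))).
- exact: (measurableT_comp (continuous_measurable_fun (@continuous_sin R))).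
Qed.

Lemma cmeasurable_lim D (f_ : nat -> R -> R[i]) f : measurable D ->
  (forall n, cmeasurable D (f_ n)) ->
  (forall t, D t -> forall e, 0 < e -> \forall n \near \oo, normc (f t - f_ n t) < e) ->
  cmeasurable D f.
Proof.
move=> mD mf_ f_f; split.
- apply: (@measurable_fun_cvg _ _ _ _ (fun n t => Re (f_ n t))).
  + by move=> n; have [] := mf_ n.
  + move=> t Dt; apply/cvgrPdist_lt => e e0.
    apply: filterS (f_f t Dt e e0) => n; apply: le_lt_trans.
    by rewrite -cReN -cReD ler_norm_Re.
- apply: (@measurable_fun_cvg _ _ _ _ (fun n t => Im (f_ n t))).
  + by move=> n; have [] := mf_ n.
  + move=> t Dt; apply/cvgrPdist_lt => e e0.
    apply: filterS (f_f t Dt e e0) => n; apply: le_lt_trans.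
    by rewrite -cImN -cImD ler_norm_Im.
Qed.

Lemma cintegrable_le D f h : measurable D -> cmeasurable D f ->
  mu.-integrable D (EFin \o h) -> (forall t, D t -> normc (f t) <= h t) ->
  cintegrable D f.
Proof.
move=> mD [f1 f2] ih fh; split;
  apply: (@le_integrable _ _ _ (@lebesgue_measure R) D mD _ (EFin \o h)) => //.
- exact/measurable_EFinP.
- move=> t Dt; rewrite lee_fin (le_trans (ler_norm_Re _))//.
  by rewrite (le_trans (fh _ Dt))// ler_norm.
- exact/measurable_EFinP.
- move=> t Dt; rewrite lee_fin (le_trans (ler_norm_Im _))//.
  by rewrite (le_trans (fh _ Dt))// ler_norm.
Qed.

Lemma cintegrable_eq D f g : measurable D -> (forall t, D t -> f t = g t) ->
  cintegrable D f -> cintegrable D g.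
Proof.
move=> mD fg [f1 f2]; split.
- by apply: eq_integrable f1 => // t /set_mem /fg /= ->.
- by apply: eq_integrable f2 => // t /set_mem /fg /= ->.
Qed.

Lemma eq_cintegral D f g : (forall t, D t -> f t = g t) ->
  cintegral D f = cintegral D g.
Proof.
by move=> fg; congr (_ +i* _); apply: eq_Rintegral => t /set_mem /fg ->.
Qed.

Lemma cintegrableD D f g : measurable D -> cintegrable D f -> cintegrable D g ->
  cintegrable D (fun t => f t + g t).
Proof.
move=> mD [f1 f2] [g1 g2]; split.
- rewrite (_ : _ \o _ = (EFin \o (fun t => Re (f t))) \+ (EFin \o (fun t => Re (g t))))%E.
    exact: (@integrableD _ _ _ (@lebesgue_measure R)).
  by apply/funext => t /=; rewrite cReD.
- rewrite (_ : _ \o _ = (EFin \o (fun t => Im (f t))) \+ (EFin \o (fun t => Im (g t))))%E.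
    exact: (@integrableD _ _ _ (@lebesgue_measure R)).
  by apply/funext => t /=; rewrite cImD.
Qed.

Lemma cintegralD D f g : measurable D -> cintegrable D f -> cintegrable D g ->
  cintegral D (fun t => f t + g t) = cintegral D f + cintegral D g.
Proof.
move=> mD [f1 f2] [g1 g2]; apply: complexP; rewrite /cintegral !(cReD, cImD)/=.
- by under eq_Rintegral do rewrite cReD; exact: RintegralD.
- by under eq_Rintegral do rewrite cImD; exact: RintegralD.
Qed.

Let integrableZr D h (r : R) : measurable D -> mu.-integrable D (EFin \o h) ->
  mu.-integrable D (EFin \o (fun t => r * h t)).
Proof.
move=> mD hi; rewrite (_ : _ \o _ = (fun t => r%:E * (EFin \o h) t)%E)//.
exact: (@integrableZl _ _ _ (@lebesgue_measure R)).
Qed.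

Lemma cintegrableZ D f c : measurable D -> cintegrable D f ->
  cintegrable D (fun t => c * f t).
Proof.
move=> mD [f1 f2].
have Z h r := @integrableZr D h r mD.
split.
- rewrite (_ : _ \o _ =
    (EFin \o (fun t => (Re c * Re (f t))%R)) \- (EFin \o (fun t => (Im c * Im (f t))%R)))%E.
    by apply: (@integrableB _ _ _ (@lebesgue_measure R)) => //; exact: Z.
  by apply/funext => t /=; rewrite cReM.
- rewrite (_ : _ \o _ =
    (EFin \o (fun t => (Re c * Im (f t))%R)) \+ (EFin \o (fun t => (Im c * Re (f t))%R)))%E.
    by apply: (@integrableD _ _ _ (@lebesgue_measure R)) => //; exact: Z.
  by apply/funext => t /=; rewrite cImM.
Qed.

Lemma cintegralZ D f c : measurable D -> cintegrable D f ->
  cintegral D (fun t => c * f t) = c * cintegral D f.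
Proof.
move=> mD [f1 f2]; have Z h r := @integrableZr D h r mD.
rewrite /cintegral; apply: complexP; rewrite (cReM, cImM) /=.
- rewrite -!(@RintegralZl _ _ _ (@lebesgue_measure R))// -RintegralB//; try exact: Z.
  by apply: eq_Rintegral => t _; rewrite cReM.
- rewrite -!(@RintegralZl _ _ _ (@lebesgue_measure R))// -RintegralD//; try exact: Z.
  by apply: eq_Rintegral => t _; rewrite cImM.
Qed.

Lemma cintegralB D f g : measurable D -> cintegrable D f -> cintegrable D g ->
  cintegral D (fun t => f t - g t) = cintegral D f - cintegral D g.
Proof.
move=> mD fi gi; have gi' := cintegrableZ (-1) mD gi.
have : cintegral D (fun t => f t + -1 * g t) = _ := cintegralD mD fi gi'.
by rewrite cintegralZ// mulN1r => <-; apply: eq_cintegral => t _; rewrite mulN1r.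
Qed.

Lemma cintegrableB D f g : measurable D -> cintegrable D f -> cintegrable D g ->
  cintegrable D (fun t => f t - g t).
Proof.
move=> mD fi gi; have := cintegrableD mD fi (cintegrableZ (-1) mD gi).
by apply: cintegrable_eq => // t _; rewrite mulN1r.
Qed.

Lemma cintegrable0 D : measurable D -> cintegrable D (fun=> 0).
Proof. by move=> mD; split; exact: integrable0. Qed.

Lemma cintegral0 D : measurable D -> cintegral D (fun=> 0) = 0.
Proof. by move=> mD; rewrite /cintegral /= Rintegral_cst// mul0r. Qed.

Lemma cintegrable_sum D (I : Type) (r : seq I) (F : I -> R -> R[i]) :
  measurable D -> (forall i, cintegrable D (F i)) ->
  cintegrable D (fun t => \sum_(i <- r) F i t).
Proof.
move=> mD iF; elim: r => [|i r IH].
  by under eq_fun do rewrite big_nil; exact: cintegrable0.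
by under eq_fun do rewrite big_cons; exact: cintegrableD.
Qed.

Lemma cintegral_sum D (I : Type) (r : seq I) (F : I -> R -> R[i]) :
  measurable D -> (forall i, cintegrable D (F i)) ->
  cintegral D (fun t => \sum_(i <- r) F i t) = \sum_(i <- r) cintegral D (F i).
Proof.
move=> mD iF; elim: r => [|i r IH].
  by under eq_fun do rewrite big_nil; rewrite big_nil cintegral0.
under eq_fun do rewrite big_cons.
by rewrite big_cons cintegralD// ?IH//; exact: cintegrable_sum.
Qed.

(** The factor 2 comes from bounding the real and imaginary parts
    separately. *)
Lemma ler_normc_cintegral D f h : measurable D -> cintegrable D f ->
  mu.-integrable D (EFin \o h) -> (forall t, D t -> normc (f t) <= h t) ->
  normc (cintegral D f) <= 2 * (\int[mu]_(t in D) h t)%R.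
Proof.
move=> mD [f1 f2] ih fh; rewrite (le_trans (ler_normc_ReIm _))//= mulr2n mulrDl mul1r.
apply: lerD; apply: (le_trans (@le_normr_Rintegral _ _ _ (@lebesgue_measure R) _ _ mD _)) => //.
- apply: le_Rintegral => //; first exact: integrable_norm.
  by move=> t Dt; rewrite (le_trans (ler_norm_Re _)) ?fh.
- apply: le_Rintegral => //; first exact: integrable_norm.
  by move=> t Dt; rewrite (le_trans (ler_norm_Im _)) ?fh.
Qed.

Lemma is_cderive_continuous f t (d : R[i]) : is_cderive f t d ->
  {for t, continuous (fun s => Re (f s))} /\ {for t, continuous (fun s => Im (f s))}.
Proof.
by move=> [f1 f2]; split; apply: differentiable_continuous;
  apply/derivable1_diffP; [have [] := f1|have [] := f2].
Qed.

Lemma improper_cFTC D (a_ b_ : nat -> R) (F f : R -> R[i]) (df : R -> R[i]) (l : R[i]) :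
  (forall n, a_ n < b_ n) -> nonincreasing_seq a_ -> nondecreasing_seq b_ ->
  D = \bigcup_n `[a_ n, b_ n]%classic ->
  (forall t, D t -> is_cderive f t (df t)) ->
  (forall t, D t -> is_cderive F t (f t)) ->
  cintegrable D f ->
  (forall e, 0 < e -> \forall n \near \oo, normc (l - (F (b_ n) - F (a_ n))) < e) ->
  cintegral D f = l.
Proof.
move=> ab ad bi DE cf dF [f1 f2] Fl; apply: complexP; rewrite /cintegral/=.
- apply: (@improper_FTC _ D a_ b_ ab ad bi DE (fun t => Re (F t))) => // [t Dt|t Dt|].
  + by have [] := is_cderive_continuous (cf _ Dt).
  + by have [] := dF _ Dt.
  + apply/cvgrPdist_lt => e /Fl; apply: filterS => n; apply: le_lt_trans.
    by rewrite -!cReN -!cReD -!cReN -cReD ler_norm_Re.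
- apply: (@improper_FTC _ D a_ b_ ab ad bi DE (fun t => Im (F t))) => // [t Dt|t Dt|].
  + by have [] := is_cderive_continuous (cf _ Dt).
  + by have [] := dF _ Dt.
  + apply/cvgrPdist_lt => e /Fl; apply: filterS => n; apply: le_lt_trans.
    by rewrite -!cImN -!cImD -!cImN -cImD ler_norm_Im.
Qed.

End ComplexIntegral.

(** * The Euler integrals: convergence and recurrences *)
Section EulerIntegrals.
Context {R : realType}.
Implicit Types (a b : R[i]) (t x y : R).

(** Raise [t / y <= e^(t/y)] to the power [y]. *)
Lemma powR_le_expR y t : 0 < y -> 0 < t -> expR (y * ln t) <= y `^ y * expR t.
Proof.
move=> y0 t0; have yn0 : y != 0 by rewrite gt_eqF.
have h : t / y <= expR (t / y) by apply: le_trans (expR_ge1Dx _); rewrite lerDr.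
have lnt : ln t <= ln y + t / y.
  have := h; rewrite -[X in X <= _]lnK ?posrE ?divr_gt0// ler_expR.
  by rewrite ln_div ?posrE// lerBlDl.
rewrite /powR (negbTE yn0) -expRD ler_expR.
rewrite (le_trans (ler_wpM2l (ltW y0) lnt))// mulrDr lerD2l.
by rewrite mulrCA divff// mulr1.
Qed.

Lemma near_expRN c e : 0 < c -> 0 < e ->
  \forall n \near \oo, expR (- (c * n.+1%:R)) < e :> R.
Proof.
move=> c0 e0; near=> n.
have cn : 0 < c * n.+1%:R by rewrite mulr_gt0.
rewrite expRN invf_plt ?posrE ?expR_gt0//.
apply: lt_le_trans (expR_ge1Dx _); apply: ltr_pwDl => //.
rewrite mulrC -ler_pdivrMr// -natr1; apply: ler_wpDr => //.
near: n; exact: nbhs_infty_ger.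
Unshelve. all: by end_near. Qed.

Lemma exhaust_pos : `]0 : R, +oo[%classic =
  \bigcup_n `[expR (- n.+1%:R), expR n.+1%:R]%classic.
Proof.
apply/seteqP; split => t /=.
  rewrite in_itv/= andbT => t0.
  exists (Num.truncn `|ln t|) => //=; rewrite in_itv/=.
  have := truncnS_gt `|ln t|; rewrite ltr_norml => /andP[l u].
  by rewrite -[X in _ <= X <= _](@lnK _ t) ?posrE// !ler_expR (ltW l) ltW.
by case=> n _ /=; rewrite !in_itv/= andbT => /andP[+ _]; apply: lt_le_trans; exact: expR_gt0.
Qed.

Lemma expRN_lt_half n : expR (- n.+1%:R) < 2^-1 :> R.
Proof.
rewrite expRN ltf_pV2 ?posrE ?expR_gt0//.
apply: (@le_lt_trans _ _ (1 + n.+1%:R)); last first.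
  by apply: expR_gt1Dx; rewrite pnatr_eq0.
by rewrite -[leLHS]/(1 + 1) lerD2l ler1n.
Qed.

Lemma exhaust01 : `]0 : R, 1[%classic =
  \bigcup_n `[expR (- n.+1%:R), 1 - expR (- n.+1%:R)]%classic.
Proof.
apply/seteqP; split => t /=.
  rewrite in_itv/= => /andP[t0 t1].
  have [n [h1 h2]] : exists n, expR (- n.+1%:R) <= t /\ expR (- n.+1%:R) <= 1 - t.
    have m0 : 0 < Order.min t (1 - t) by rewrite lt_min t0 subr_gt0.
    have [n _ /(_ n (leqnn _))] := near_expRN ltr01 m0.
    by rewrite mul1r lt_min => /andP[/ltW ? /ltW ?]; exists n.
  by exists n => //=; rewrite in_itv/= h1 lerBrDr -lerBrDl.
case=> n _ /=; rewrite !in_itv/= => /andP[h1 h2]; have h0 := expR_gt0 (- n.+1%:R : R).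
by rewrite (lt_le_trans h0 h1) (le_lt_trans h2)// ltrBlDr ltrDl.
Qed.

Lemma exhaust_pos_lt n : expR (- n.+1%:R) < expR n.+1%:R :> R.
Proof. by rewrite ltr_expR; apply: (@lt_trans _ _ 0); rewrite ?oppr_lt0. Qed.

Lemma exhaust01_lt n : expR (- n.+1%:R) < 1 - expR (- n.+1%:R) :> R.
Proof. by have := expRN_lt_half n; lra. Qed.

Lemma exhaust_left_dec : nonincreasing_seq (fun n => expR (- n.+1%:R) : R).
Proof. by move=> m n mn; rewrite ler_expR lerN2 ler_nat. Qed.

Lemma exhaust_pos_right_inc : nondecreasing_seq (fun n => expR n.+1%:R : R).
Proof. by move=> m n mn; rewrite ler_expR ler_nat. Qed.

Lemma exhaust01_right_inc : nondecreasing_seq (fun n => 1 - expR (- n.+1%:R) : R).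
Proof. by move=> m n mn; rewrite lerD2l lerN2; exact: exhaust_left_dec. Qed.

Lemma is_derive_cont (f : R -> R) t (d : R) : is_derive t 1 f d -> {for t, continuous f}.
Proof.
by move=> [h _]; apply: differentiable_continuous; exact/derivable1_diffP.
Qed.

Lemma is_derive_powln x t : 0 < t ->
  is_derive t 1 (fun s => expR (x * ln s)) (x * expR ((x - 1) * ln t)).
Proof.
move=> t0; have lnt := is_derive1_ln t0.
have : is_derive t 1 (expR \o (fun s => x * ln s)) (expR (x * ln t) * (x * t^-1)).
  apply: is_derive_eq.
  by rewrite /GRing.scale /=; ring.
rewrite (_ : _ * _ = x * expR ((x - 1) * ln t))//.
rewrite mulrBl mul1r expRB lnK ?posrE//; ring.
Qed.

(** The weight is dominated by a multiple of the derivative of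
    [- 1 / (1 + t^x)], a bounded function, because [(1 + t^x)^2 = O(e^t)]. *)
Lemma integrable_gamma_weight x : 0 < x ->
  mu.-integrable `]0, +oo[ (EFin \o (fun t => expR ((x - 1) * ln t - t))).
Proof.
move=> x0.
pose f := fun t : R => x * expR ((x - 1) * ln t) *
    ((1 + expR (x * ln t))^-1 * (1 + expR (x * ln t))^-1).
have den t : 1 + expR (x * ln t) != 0 by rewrite gt_eqF// addr_gt0 ?expR_gt0.
have dinv t : 0 < t -> is_derive t 1 (fun s => (1 + expR (x * ln s))^-1)
    (- (1 + expR (x * ln t)) ^- 2 * (0 + x * expR ((x - 1) * ln t))).
  move=> t0; have D1 := is_derive_powln x t0.
  have D2 : is_derive t 1 (cst 1 + (fun s => expR (x * ln s)))
      (0 + x * expR ((x - 1) * ln t)) by apply: is_deriveD.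
  have dent : (cst 1 + (fun s => expR (x * ln s))) t != 0 := den t.
  exact: (is_deriveV dent D2).
have fi : mu.-integrable `]0 : R, +oo[ (EFin \o f).
  apply: (@integrable_improper_FTC _ _ _ _ exhaust_pos_lt exhaust_left_dec
    exhaust_pos_right_inc exhaust_pos
    (fun t => - (1 + expR (x * ln t))^-1) f _ _ 1).
  - move=> t /=; rewrite in_itv/= andbT => t0.
    have c1 : {for t, continuous (fun s => x * expR ((x - 1) * ln s))}.
      apply: continuousM; [exact: cst_continuous|exact: is_derive_cont (is_derive_powln _ t0)].
    have c2 := is_derive_cont (dinv t t0).
    exact: (continuousM c1 (continuousM c2 c2)).
  - move=> t /=; rewrite in_itv/= andbT => t0.
    have D3 := dinv t t0.
    by apply: is_derive_eq; rewrite /f; field; exact: den.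
  - move=> t _; apply: mulr_ge0; first by rewrite mulr_ge0 ?expR_ge0// ltW.
    by rewrite -expr2 sqr_ge0.
  - move=> n; rewrite opprK addrC lerBlDr.
    rewrite (@le_trans _ _ 1)//; last by rewrite lerDl invr_ge0 addr_ge0 ?expR_ge0.
    by rewrite invf_le1 ?lerDl ?expR_ge0// addr_gt0 ?expR_gt0.
(* (1 + T) ^+ 2 <= 2 + 2 * T ^+ 2, and T ^+ 2 = t `^ (2 * x) is bounded by
   powR_le_expR. *)
pose C := (2 + 2 * (2 * x) `^ (2 * x)) / x.
have fi' : mu.-integrable `]0 : R, +oo[ (fun t => C%:E * (EFin \o f) t)%E.
  exact: (@integrableZl _ _ _ (@lebesgue_measure R)).
apply: (@le_integrable _ _ _ (@lebesgue_measure R) _ (measurable_itv _) _ _ _ _ fi').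
- apply/measurable_EFinP; apply: measurableT_comp (@measurable_expR R) _.
  apply: measurable_funB => //; apply: measurable_funM => //.
  exact: measurable_funS (@measurable_ln R).
- move=> t /=; rewrite in_itv/= andbT => t0.
  rewrite lee_fin ger0_norm ?expR_ge0// (le_trans _ (ler_norm _))//.
  rewrite expRD /f /C; set E := expR ((x - 1) * ln t); set T := expR (x * ln t).
  have E0 : 0 < E by exact: expR_gt0.
  have T0 : 0 < T by exact: expR_gt0.
  rewrite [leRHS](_ : _ = E * ((2 + 2 * (2 * x) `^ (2 * x)) / (1 + T) ^+ 2)); last first.
    by field; apply/andP; split; rewrite gt_eqF// addr_gt0.
  rewrite ler_pM2l// ler_pdivlMr ?exprn_gt0 ?addr_gt0//.
  rewrite expRN mulrC ler_pdivrMr ?expR_gt0//.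
  apply: (@le_trans _ _ (2 + 2 * T ^+ 2)).
    by have := sqr_ge0 (1 - T); lra.
  have -> : T ^+ 2 = expR ((2 * x) * ln t).
    by rewrite /T -expRM_natl; congr expR; ring.
  have := @powR_le_expR (2 * x) t ltac:(lra) t0.
  have : 1 <= expR t by rewrite -[leLHS]expR0 ler_expR ltW.
  set A := expR t; set B := expR (_ * _); set K := _ `^ _ => h1 h2.
  lra.
Qed.

(** At each [t] one of the two powers has its base in [[1/2, 1]] and is
    bounded, so the weight is dominated by a multiple of
    [t^(x-1) + (1-t)^(y-1)], whose primitive [t^x/x - (1-t)^y/y] is
    bounded. *)
Lemma integrable_beta_weight x y : 0 < x -> 0 < y ->
  mu.-integrable `]0, 1[ (EFin \o (fun t => expR ((x - 1) * ln t + (y - 1) * ln (1 - t)))).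
Proof.
move=> x0 y0.
have xn0 : x != 0 by rewrite gt_eqF.
have yn0 : y != 0 by rewrite gt_eqF.
pose f := fun t : R => expR ((x - 1) * ln t) + expR ((y - 1) * ln (1 - t)).
have onem z t : t < 1 -> is_derive t 1 (fun s => expR (z * ln (1 - s)))
    (- (z * expR ((z - 1) * ln (1 - t)))).
  move=> t1; have t10 : 0 < 1 - t by rewrite subr_gt0.
  have D1 := is_derive_powln z t10.
  have D2 : is_derive t 1 ((fun s => expR (z * ln s)) \o (fun s => 1 - s))
      ((z * expR ((z - 1) * ln (1 - t))) * (0 - 1)).
    by apply: is_derive1_comp.
  by apply: is_derive_eq; ring.
have fi : mu.-integrable `]0 : R, 1[ (EFin \o f).
  apply: (@integrable_improper_FTC _ _ _ _ exhaust01_lt exhaust_left_dec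
    exhaust01_right_inc exhaust01
    (fun t => x^-1 * expR (x * ln t) - y^-1 * expR (y * ln (1 - t))) f _ _ (x^-1 + y^-1)).
  - move=> t /=; rewrite in_itv/= => /andP[t0 t1].
    apply: continuousD; first exact: is_derive_cont (is_derive_powln _ t0).
    exact: is_derive_cont (onem (y - 1) _ t1).
  - move=> t /=; rewrite in_itv/= => /andP[t0 t1].
    have D1 := is_derive_powln x t0.
    have D2 := onem y _ t1.
    by apply: is_derive_eq; rewrite /f /GRing.scale/=; field; rewrite xn0 yn0.
  - by move=> t _; rewrite /f addr_ge0 ?expR_ge0.
  - move=> n.
    have E : 0 < expR (- n.+1%:R : R) by exact: expR_gt0.
    have L : expR (- n.+1%:R : R) < 2^-1 by exact: expRN_lt_half.
    have le1 z s : 0 < z -> s <= 1 -> expR (z * ln s) <= 1.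
      move=> z0 s0; rewrite -[leRHS]expR0 ler_expR pmulr_rle0// ln_le0//.
    set e := expR _ in E L *.
    have h1 : x^-1 * expR (x * ln (1 - e)) <= x^-1.
      by apply: ler_piMr; [rewrite invr_ge0 ltW|apply: le1 => //; lra].
    have h2 : 0 <= y^-1 * expR (y * ln (1 - (1 - e))).
      by rewrite mulr_ge0 ?expR_ge0// invr_ge0 ltW.
    have h3 : 0 <= x^-1 * expR (x * ln e).
      by rewrite mulr_ge0 ?expR_ge0// invr_ge0 ltW.
    have h4 : y^-1 * expR (y * ln (1 - e)) <= y^-1.
      by apply: ler_piMr; [rewrite invr_ge0 ltW|apply: le1 => //; lra].
    lra.
pose C := expR (`|x - 1| * ln 2) + expR (`|y - 1| * ln 2).
have fi' : mu.-integrable `]0 : R, 1[ (fun t => C%:E * (EFin \o f) t)%E.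
  exact: (@integrableZl _ _ _ (@lebesgue_measure R)).
apply: (@le_integrable _ _ _ (@lebesgue_measure R) _ (measurable_itv _) _ _ _ _ fi').
- apply/measurable_EFinP; apply: measurableT_comp (@measurable_expR R) _.
  apply: measurable_funD; apply: measurable_funM => //.
    exact: measurable_funS (@measurable_ln R).
  apply: (measurable_funS measurableT) => //.
  by apply: measurableT_comp (@measurable_ln R) _; exact: measurable_funB.
- move=> t /=; rewrite in_itv/= => /andP[t0 t1].
  have half z s : 2^-1 <= s -> s <= 1 -> expR (z * ln s) <= expR (`|z| * ln 2).
    move=> s2 s1; rewrite ler_expR (le_trans (ler_norm _))// normrM.
    rewrite ler_wpM2l// ler0_norm ?ln_le0// lerNl -lnV ?posrE//.
    by rewrite ler_ln ?posrE ?invr_gt0//; lra.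
  rewrite lee_fin ger0_norm ?expR_ge0// (le_trans _ (ler_norm _))//.
  rewrite expRD /f /C; set E := expR ((x - 1) * ln t); set T := expR ((y - 1) * ln (1 - t)).
  have E0 : 0 < E by exact: expR_gt0.
  have T0 : 0 < T by exact: expR_gt0.
  set C1 := expR (`|x - 1| * _); set C2 := expR (`|y - 1| * _).
  have C10 : 0 < C1 by exact: expR_gt0.
  have C20 : 0 < C2 by exact: expR_gt0.
  case: (leP t 2^-1) => t2.
  + have : T <= C2 by apply: half; lra.
    by nra.
  + have : E <= C1 by apply: half; lra.
    by nra.
Qed.

(** The integrands of the Euler integrals, written with [ln] so that the
    rules of differentiation apply on a neighbourhood of each point; they
    agree with products of powers by [gammafE] and [betafE]. *)
Definition gammaf a t : R[i] := cexp ((a - 1) * (ln t)%:C - t%:C).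

Definition betaf a b t : R[i] :=
  cexp ((a - 1) * (ln t)%:C + (b - 1) * (ln (1 - t))%:C).

Definition Bint a b : R[i] := cintegral `]0, 1[ (betaf a b).

Lemma normc_gammaf a t : normc (gammaf a t) = expR ((Re a - 1) * ln t - t).
Proof. by rewrite normc_cexp !(cReD, cReN, cReM)/= mulr0 subr0. Qed.

Lemma normc_betaf a b t :
  normc (betaf a b t) = expR ((Re a - 1) * ln t + (Re b - 1) * ln (1 - t)).
Proof. by rewrite normc_cexp !(cReD, cReN, cReM)/= !mulr0 !subr0. Qed.

Lemma cln_measurable D : cmeasurable D (fun t : R => (ln t)%:C).
Proof. by apply: cmeasurable_real; exact: measurable_funS (@measurable_ln R). Qed.

Lemma cln1_measurable D : cmeasurable D (fun t : R => (ln (1 - t))%:C).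
Proof.
apply: cmeasurable_real; apply: (measurable_funS measurableT) => //.
by apply: measurableT_comp (@measurable_ln R) _; exact: measurable_funB.
Qed.

Lemma gammaf_measurable D a : cmeasurable D (gammaf a).
Proof.
apply: cmeasurable_cexp; apply: cmeasurableD.
  by apply: cmeasurableM; [exact: cmeasurable_cst|exact: cln_measurable].
rewrite (_ : (fun t => _) = (fun t : R => (- t)%:C)); last first.
  by apply/funext => t; rewrite rmorphN.
by apply: cmeasurable_real; apply: (measurable_funS measurableT) => //; exact: oppr_measurable.
Qed.

Lemma betaf_measurable D a b : cmeasurable D (betaf a b).
Proof.
apply: cmeasurable_cexp; apply: cmeasurableD; apply: cmeasurableM;
  [exact: cmeasurable_cst|exact: cln_measurable|exact: cmeasurable_cst|exact: cln1_measurable].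
Qed.

Lemma gammaf_integrable a : 0 < Re a -> cintegrable `]0, +oo[ (gammaf a).
Proof.
move=> a0; apply: (cintegrable_le _ _ (integrable_gamma_weight a0)) => //.
  exact: gammaf_measurable.
by move=> t _; rewrite normc_gammaf.
Qed.

Lemma betaf_integrable a b : 0 < Re a -> 0 < Re b -> cintegrable `]0, 1[ (betaf a b).
Proof.
move=> a0 b0; apply: (cintegrable_le _ _ (integrable_beta_weight a0 b0)) => //.
  exact: betaf_measurable.
by move=> t _; rewrite normc_betaf.
Qed.

Lemma gammafE a t : 0 < t -> gammaf a t = cpow t%:C (a - 1) * (expR (- t))%:C.
Proof. by move=> t0; rewrite /gammaf cpow_pos// -cexp_real -cexpD rmorphN. Qed.

Lemma betafE a b t : 0 < t < 1 ->
  betaf a b t = cpow t%:C (a - 1) * cpow (1 - t%:C) (b - 1).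
Proof.
move=> /andP[t0 t1]; rewrite /betaf cexpD (_ : 1 - t%:C = (1 - t)%:C).
  by rewrite !cpow_pos// subr_gt0.
by rewrite rmorphB.
Qed.

Lemma gammafDn a n t : 0 < t -> gammaf (a + n%:R) t = t%:C ^+ n * gammaf a t.
Proof.
move=> t0; rewrite !gammafE// [a + _ - 1]addrAC cpowDn//; ring.
Qed.

Lemma betafDn a b m n t : 0 < t < 1 ->
  betaf (a + m%:R) (b + n%:R) t = t%:C ^+ m * (1 - t)%:C ^+ n * betaf a b t.
Proof.
move=> t01; have /andP[t0 t1] := t01.
rewrite !betafE// (_ : 1 - t%:C = (1 - t)%:C); last by rewrite rmorphB.
by rewrite [a + _ - 1]addrAC [b + _ - 1]addrAC !cpowDn// ?subr_gt0//; ring.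
Qed.

Lemma is_cderive_gammaf a t : 0 < t ->
  is_cderive (gammaf a) t (((a - 1) * (t^-1)%:C - 1) * gammaf a t).
Proof.
move=> t0; have lnt := is_derive1_ln t0.
apply: is_cderive_cexp; apply: is_cderiveD.
  by apply: is_cderiveZ; exact: is_cderive_real.
apply: (is_cderiveE (is_cderiveZ (-1) (is_cderive_real (is_derive_id t 1)))).
  by move=> s; rewrite mulN1r.
by rewrite mulN1r.
Qed.

Lemma is_cderive_betaf a b t : 0 < t < 1 ->
  is_cderive (betaf a b) t
    (((a - 1) * (t^-1)%:C - (b - 1) * ((1 - t)^-1)%:C) * betaf a b t).
Proof.
move=> /andP[t0 t1]; have lnt := is_derive1_ln t0.
have t10 : 0 < 1 - t by rewrite subr_gt0.
have lnt1 := is_derive1_ln t10.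
have D : is_derive t 1 (@ln R \o (fun s => 1 - s)) ((1 - t)^-1 * (0 - 1)).
  by apply: is_derive1_comp.
apply: is_cderive_cexp; apply: is_cderiveD.
  by apply: is_cderiveZ; exact: is_cderive_real.
apply: (is_cderiveE (is_cderiveZ (b - 1) (is_cderive_real D))) => //.
by rewrite sub0r mulrN1 rmorphN mulrN.
Qed.

Lemma euler_gammaE a : euler_gamma a = cintegral `]0, +oo[ (gammaf a).
Proof.
by apply: eq_cintegral => t /=; rewrite in_itv/= andbT => t0; rewrite gammafE.
Qed.

Lemma GammaE a : 0 < Re a -> Gamma a = cintegral `]0, +oo[ (gammaf a).
Proof. by move=> a0; rewrite /Gamma a0 euler_gammaE. Qed.

Lemma expR_ln_expRN x n : expR (x * ln (expR (- n.+1%:R))) = expR (- (x * n.+1%:R)) :> R.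
Proof. by rewrite expRK mulrN. Qed.

(** Integrate the derivative of [t^a e^(-t)], which vanishes at both ends. *)
Lemma Gamma1p a : 0 < Re a -> Gamma (a + 1) = a * Gamma a.
Proof.
move=> a0; have a10 : 0 < Re (a + 1) by rewrite cReD/= addr_gt0.
rewrite !GammaE//.
have i0 := gammaf_integrable a0; have i1 := gammaf_integrable a10.
suff : cintegral `]0, +oo[ (fun t => a * gammaf a t - gammaf (a + 1) t) = 0.
  rewrite cintegralB// ?cintegralZ//; last exact: cintegrableZ.
  by move/eqP; rewrite subr_eq0 => /eqP.
have step t : 0 < t -> gammaf (a + 1) t = t%:C * gammaf a t.
  by move=> t0; rewrite (gammafDn a 1 t0) expr1.
apply: (improper_cFTC exhaust_pos_lt exhaust_left_dec exhaust_pos_right_inc exhaust_pos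
  (F := gammaf (a + 1))
  (df := fun t => a * (((a - 1) * (t^-1)%:C - 1) * gammaf a t) +
     (-1) * ((((a + 1) - 1) * (t^-1)%:C - 1) * gammaf (a + 1) t))).
- move=> t /=; rewrite in_itv/= andbT => t0.
  apply: (is_cderiveE (is_cderiveD (is_cderiveZ a (is_cderive_gammaf a t0))
    (is_cderiveZ (-1) (is_cderive_gammaf (a + 1) t0)))) => //.
  by move=> s; rewrite mulN1r.
- move=> t /=; rewrite in_itv/= andbT => t0.
  apply: (is_cderiveE (is_cderive_gammaf (a + 1) t0)) => //.
  have tC : (t^-1)%:C * t%:C = 1 :> R[i] by rewrite -rmorphM/= mulVf ?gt_eqF.
  rewrite addrK mulrBl mul1r; congr (_ - _).
  by rewrite step// -mulrA; congr (_ * _); rewrite mulrA tC mul1r.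
- by apply: cintegrableB => //; exact: cintegrableZ.
- move=> e e0.
  pose y := Re a + 1; pose K := y `^ y.
  have y0 : 0 < y by rewrite addr_gt0.
  have K0 : 0 < K by rewrite powR_gt0.
  have e2 : 0 < e / 2 by rewrite divr_gt0.
  have eK : 0 < e / 2 / K by rewrite divr_gt0.
  near=> n.
  rewrite sub0r normcN (le_lt_trans (ler_normcB _ _))// [e]splitr ltrD//.
  + rewrite normc_gammaf cReD/= addrK.
    set t := expR n.+1%:R.
    have t0 : 0 < t by exact: expR_gt0.
    rewrite expRB ltr_pdivrMr ?expR_gt0//.
    have := powR_le_expR y0 t0; rewrite -/K.
    rewrite /y mulrDl mul1r expRD lnK ?posrE//.
    rewrite -ler_pdivlMr// => h; apply: (le_lt_trans h).
    rewrite mulrAC ltr_pM2r ?expR_gt0//.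
    rewrite mulrC -ltr_pdivlMr// -expRN.
    rewrite -[X in expR (- X)]mul1r.
    by near: n; exact: near_expRN.
  + rewrite normc_gammaf cReD/= addrK expRD expR_ln_expRN.
    apply: (@le_lt_trans _ _ (expR (- (Re a * n.+1%:R)))).
      by apply: ler_piMr; rewrite ?expR_ge0// expR_le1 oppr_le0 expR_ge0.
    by near: n; exact: near_expRN.
Unshelve. all: by end_near. Qed.

(** Integrate the derivative of [t^a (1-t)^b], which vanishes at both ends. *)
Lemma Bint_rec a b : 0 < Re a -> 0 < Re b ->
  a * Bint a (b + 1) = b * Bint (a + 1) b.
Proof.
move=> a0 b0; have a10 : 0 < Re (a + 1) by rewrite cReD/= addr_gt0.
have b10 : 0 < Re (b + 1) by rewrite cReD/= addr_gt0.
have i0 := betaf_integrable a0 b10; have i1 := betaf_integrable a10 b0.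
suff : cintegral `]0, 1[ (fun t => a * betaf a (b + 1) t - b * betaf (a + 1) b t) = 0.
  rewrite cintegralB// ?cintegralZ//; try exact: cintegrableZ.
  by move/eqP; rewrite subr_eq0 => /eqP.
have step1 t : 0 < t < 1 -> betaf (a + 1) (b + 1) t = t%:C * betaf a (b + 1) t.
  by move=> t0; have := betafDn a (b + 1) 1 0 t0; rewrite addr0 expr1 expr0 mulr1.
have step2 t : 0 < t < 1 -> betaf (a + 1) (b + 1) t = (1 - t)%:C * betaf (a + 1) b t.
  by move=> t0; have := betafDn (a + 1) b 0 1 t0; rewrite addr0 expr1 expr0 mul1r.
apply: (improper_cFTC exhaust01_lt exhaust_left_dec exhaust01_right_inc exhaust01
  (F := betaf (a + 1) (b + 1))
  (df := fun t => a * (((a - 1) * (t^-1)%:C - (b + 1 - 1) * ((1 - t)^-1)%:C) * betaf a (b + 1) t) +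
     (- b) * (((a + 1 - 1) * (t^-1)%:C - (b - 1) * ((1 - t)^-1)%:C) * betaf (a + 1) b t))).
- move=> t /=; rewrite in_itv/= => t0.
  apply: (is_cderiveE (is_cderiveD (is_cderiveZ a (is_cderive_betaf a (b + 1) t0))
    (is_cderiveZ (- b) (is_cderive_betaf (a + 1) b t0)))) => //.
  by move=> s; rewrite mulNr.
- move=> t /=; rewrite in_itv/= => t01; have /andP[t0 t1] := t01.
  apply: (is_cderiveE (is_cderive_betaf (a + 1) (b + 1) t01)) => //.
  have tC : (t^-1)%:C * t%:C = 1 :> R[i] by rewrite -rmorphM/= mulVf ?gt_eqF.
  have tC1 : ((1 - t)^-1)%:C * (1 - t)%:C = 1 :> R[i].
    by rewrite -rmorphM/= mulVf// gt_eqF// subr_gt0.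
  rewrite !addrK mulrBl; congr (_ - _).
  + by rewrite step1// -mulrA; congr (_ * _); rewrite mulrA tC mul1r.
  + by rewrite step2// -mulrA; congr (_ * _); rewrite mulrA tC1 mul1r.
- by apply: cintegrableB => //; exact: cintegrableZ.
- move=> e e0.
  have e2 : 0 < e / 2 by rewrite divr_gt0.
  near=> n.
  have n0 : 0 < expR (- n.+1%:R : R) by exact: expR_gt0.
  have n1 : expR (- n.+1%:R : R) < 2^-1 by exact: expRN_lt_half.
  have le1 z s : 0 < z -> s <= 1 -> expR (z * ln s) <= 1 :> R.
    move=> z0 s0; rewrite -[leRHS]expR0 ler_expR pmulr_rle0// ln_le0//.
  have E : 1 - (1 - expR (- n.+1%:R)) = expR (- n.+1%:R) :> R by ring.
  rewrite sub0r normcN (le_lt_trans (ler_normcB _ _))// [e]splitr ltrD//.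
  + rewrite normc_betaf !cReD/= !addrK expRD E expR_ln_expRN.
    apply: (@le_lt_trans _ _ (expR (- (Re b * n.+1%:R)))).
      apply: ler_piMl; rewrite ?expR_ge0//; apply: le1 => //.
    by near: n; exact: near_expRN.
  + rewrite normc_betaf !cReD/= !addrK expRD expR_ln_expRN.
    apply: (@le_lt_trans _ _ (expR (- (Re a * n.+1%:R)))).
      apply: ler_piMr; rewrite ?expR_ge0//; apply: le1 => //.
    by near: n; exact: near_expRN.
Unshelve. all: by end_near. Qed.

End EulerIntegrals.

(** * Shifts of the Gamma and Beta integrals *)
Section Pochhammer.
Context {R : realType}.
Implicit Types (a b : R[i]).

Lemma pochhammer0 a : pochhammer a 0 = 1.
Proof. by rewrite /pochhammer big_ord0. Qed.

Lemma pochhammerSr a n : pochhammer a n.+1 = pochhammer a n * (a + n%:R).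
Proof. by rewrite /pochhammer big_ord_recr. Qed.

Lemma pochhammerD a m n : pochhammer a (m + n) = pochhammer a m * pochhammer (a + m%:R) n.
Proof.
elim: n => [|n IH]; first by rewrite addn0 pochhammer0 mulr1.
by rewrite addnS !pochhammerSr IH -mulrA natrD addrA.
Qed.

Lemma pochhammerSl a n : pochhammer a n.+1 = a * pochhammer (a + 1) n.
Proof. by rewrite -add1n pochhammerD pochhammerSr pochhammer0 mul1r addr0. Qed.

Lemma Re_gt0_addn a n : 0 < Re a -> 0 < Re (a + n%:R).
Proof. by move=> a0; rewrite cReD cReMn_nat ltr_wpDr. Qed.

Lemma Re_gt0_neq0 a : 0 < Re a -> a != 0.
Proof. by apply: contraTneq => ->; rewrite ltxx. Qed.

Lemma pochhammer_neq0 a n : 0 < Re a -> pochhammer a n != 0.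
Proof.
move=> a0; elim: n => [|n IH]; first by rewrite pochhammer0 oner_neq0.
by rewrite pochhammerSr mulf_neq0// Re_gt0_neq0// Re_gt0_addn.
Qed.

Lemma pochhammer1 n : pochhammer (1 : R[i]) n = n`!%:R.
Proof.
elim: n => [|n IH]; first by rewrite pochhammer0.
by rewrite pochhammerSr IH nat1r mulrC -natrM -factS.
Qed.

Lemma pochhammer2 n : pochhammer (2 : R[i]) n = n.+1`!%:R.
Proof. by rewrite -pochhammer1 pochhammerSl mul1r. Qed.

Lemma Re1_gt0 : 0 < Re (1 : R[i]). Proof. exact: ltr01. Qed.

Lemma GammaDn a n : 0 < Re a -> Gamma (a + n%:R) = pochhammer a n * Gamma a.
Proof.
move=> a0; elim: n => [|n IH]; first by rewrite addr0 pochhammer0 mul1r.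
rewrite -natr1 addrA Gamma1p ?Re_gt0_addn// IH pochhammerSr; ring.
Qed.

Lemma Gamma1 : Gamma (1 : R[i]) = 1.
Proof.
rewrite (GammaE Re1_gt0).
have i0 := gammaf_integrable Re1_gt0.
apply: (improper_cFTC (@exhaust_pos_lt R) (@exhaust_left_dec R)
  (@exhaust_pos_right_inc R) exhaust_pos
  (F := fun t => -1 * gammaf 1 t)).
- by move=> t /=; rewrite in_itv/= andbT => t0; exact: is_cderive_gammaf.
- move=> t /=; rewrite in_itv/= andbT => t0.
  apply: (is_cderiveE (is_cderiveZ (-1) (is_cderive_gammaf 1 t0))) => //.
  ring.
- exact: i0.
- move=> e e0; have e2 : 0 < e / 2 by rewrite divr_gt0.
  have E s : gammaf 1 s = (expR (- s))%:C :> R[i].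
    by rewrite /gammaf subrr mul0r sub0r -rmorphN cexp_real.
  near=> n.
  rewrite !E; set u := expR (- n.+1%:R); set v := expR n.+1%:R.
  rewrite (_ : _ - _ = (1 - expR (- u) + expR (- v))%:C); last first.
    by rewrite rmorphD rmorphB/=; ring.
  have u0 : 0 < u by exact: expR_gt0.
  have v0 : 0 < v by exact: expR_gt0.
  have h1 : expR (- u) <= 1 by rewrite expR_le1 oppr_le0 ltW.
  have h2 : 1 - u <= expR (- u) by exact: expR_ge1Dx.
  have h3 : expR (- v) <= u.
    rewrite /u -[n.+1%:R]expRK -/v ler_expR lerN2 /v expRK.
    by rewrite (le_trans _ (expR_ge1Dx _))// lerDr.
  have h5 : 0 < expR (- v) by exact: expR_gt0.
  have h4 : u < e / 2.
    rewrite /u -[X in expR (- X)]mul1r; near: n; exact: near_expRN.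
  rewrite normc_ge0_real; lra.
Unshelve. all: by end_near. Qed.

Lemma Gamma_nat n : Gamma (n.+1%:R : R[i]) = n`!%:R.
Proof. by rewrite -nat1r GammaDn ?Re1_gt0// Gamma1 mulr1 pochhammer1. Qed.

(** Multiply the integrand by [1 = t + (1 - t)]. *)
Lemma Bint_split a b : 0 < Re a -> 0 < Re b ->
  Bint a b = Bint (a + 1) b + Bint a (b + 1).
Proof.
move=> a0 b0; have a10 := Re_gt0_addn 1 a0; have b10 := Re_gt0_addn 1 b0.
rewrite /Bint -cintegralD//; [|exact: betaf_integrable|exact: betaf_integrable].
apply: eq_cintegral => t /=; rewrite in_itv/= => t01.
have := betafDn a b 1 0 t01; have := betafDn a b 0 1 t01.
rewrite !addr0 => -> ->; rewrite !expr0 !expr1 rmorphB/=; ring.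
Qed.

Lemma Bint_recl a b : 0 < Re a -> 0 < Re b ->
  (a + b) * Bint (a + 1) b = a * Bint a b.
Proof.
by move=> a0 b0; rewrite (Bint_split a0 b0) mulrDr (Bint_rec a0 b0) mulrDl.
Qed.

Lemma Bint_recr a b : 0 < Re a -> 0 < Re b ->
  (a + b) * Bint a (b + 1) = b * Bint a b.
Proof.
by move=> a0 b0; rewrite (Bint_split a0 b0) mulrDr -(Bint_rec a0 b0) mulrDl addrC.
Qed.

Lemma BintDn a b j k : 0 < Re a -> 0 < Re b ->
  pochhammer (a + b) (j + k) * Bint (a + j%:R) (b + k%:R) =
  pochhammer a j * pochhammer b k * Bint a b.
Proof.
move=> a0 b0; elim: j => [|j IH].
  elim: k => [|k IH]; first by rewrite !pochhammer0 !addr0 !mul1r.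
  rewrite addnS !pochhammerSr addr0 add0n.
  have := Bint_recr a0 (Re_gt0_addn k b0).
  rewrite -[b + k.+1%:R](_ : b + k%:R + 1 = _); last by rewrite -addrA natr1.
  rewrite addrA -mulrA => ->; rewrite mulrCA.
  by move: IH; rewrite addr0 add0n => ->; ring.
rewrite addSn !pochhammerSr.
have := Bint_recl (Re_gt0_addn j a0) (Re_gt0_addn k b0).
rewrite -[a + j.+1%:R](_ : a + j%:R + 1 = _); last by rewrite -addrA natr1.
rewrite (_ : a + j%:R + (b + k%:R) = a + b + (j + k)%:R); last by rewrite natrD; ring.
rewrite -mulrA => ->; rewrite mulrCA IH; ring.
Qed.

Lemma Bint11 : Bint (1 : R[i]) 1 = 1.
Proof.
rewrite /Bint (eq_cintegral (g := fun=> 1)); last first.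
  by move=> t _; rewrite /betaf subrr !mul0r addr0 cexp0.
rewrite /cintegral /= !(@Rintegral_cst _ _ _ (@lebesgue_measure R))// mul0r mul1r.
rewrite [X in fine X](_ : _ = 1%E)//.
by have := @lebesgue_measure_itv R (`]0, 1[); rewrite /= lte_fin ltr01 -EFinB subr0.
Qed.

Lemma BintS n : Bint (n.+1%:R : R[i]) n.+1%:R = n`!%:R ^+ 2 / (n + n).+1`!%:R.
Proof.
have := BintDn n n Re1_gt0 Re1_gt0.
rewrite Bint11 !pochhammer1 (_ : 1 + 1 = 2)// pochhammer2 !nat1r mulr1 -expr2 => <-.
by rewrite mulrC mulKf// pnatr_eq0 -lt0n fact_gt0.
Qed.

End Pochhammer.

(** * Limits in the complex plane *)
Section ComplexLimits.
Context {R : realType}.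

Lemma ccvgP (u : nat -> R[i]^o) (l : R[i]) :
  (forall e : R, 0 < e -> \forall n \near \oo, normc (l - u n) < e) <->
  u n @[n --> \oo] --> (l : R[i]^o).
Proof.
split=> [H|H].
  apply/cvgrPdist_lt => e e0.
  have eR : e = (Re e)%:C by rewrite RRe_real// gtr0_real.
  have : 0 < Re e by rewrite -ltcR -eR.
  move=> /H; apply: filterS => n.
  by rewrite eR -ltcR.
move=> e e0; move/cvgrPdist_lt : H => /(_ e%:C).
rewrite ltcR => /(_ e0); apply: filterS => n.
by rewrite -ltcR.
Qed.

End ComplexLimits.

(** * Complex powers near 1 *)
Section PowerNearOne.
Context {R : realType}.
Implicit Types (a w : R[i]) (x y u t : R).

Lemma ler_norm_MVT (f f' : R -> R) M t : 0 <= t ->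
  (forall s, 0 <= s <= t -> is_derive s 1 f (f' s)) ->
  (forall s, 0 <= s <= t -> `|f' s| <= M) -> `|f t - f 0| <= M * t.
Proof.
rewrite le_eqVlt => /predU1P[<- _ _|t0 df f'M].
  by rewrite subrr normr0 mulr0.
have [s| |s st ->] := @MVT _ f f' 0 t t0.
- by move=> s01; apply: df; move: s01; rewrite in_itv/= => /andP[/ltW -> /ltW].
- apply: derivable_within_continuous => s; rewrite in_itv/= => /df[].
  by [].
rewrite subr0 normrM (ger0_norm (ltW t0)); apply: ler_wpM2r; first exact: ltW.
apply: f'M.
by move: st; rewrite in_itv/= => /andP[/ltW -> /ltW].
Qed.

Lemma ler_norm_sin y : `|sin y| <= `|y|.
Proof.
have H t : 0 <= t -> `|sin t| <= t.
  move=> t0; have := @ler_norm_MVT sin cos 1 t t0.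
  rewrite sin0 subr0 mul1r; by apply => s _; exact: cos_max.
case: (leP 0 y) => y0; first by rewrite (ger0_norm y0) H.
by rewrite -normrN -sinN (ltr0_norm y0) H// oppr_ge0 ltW.
Qed.

Lemma ler_norm_cos1 y : `|cos y - 1| <= `|y|.
Proof.
have H t : 0 <= t -> `|cos t - 1| <= t.
  move=> t0; have := @ler_norm_MVT cos (fun s => - sin s) 1 t t0.
  rewrite cos0 mul1r; apply => s _.
  by rewrite normrN; exact: sin_max.
case: (leP 0 y) => y0; first by rewrite (ger0_norm y0) H.
by rewrite -cosN (ltr0_norm y0) H// oppr_ge0 ltW.
Qed.

Lemma ler_norm_expR1 x : `|expR x - 1| <= `|x| * (1 + expR x).
Proof.
have E0 : 0 < expR x by exact: expR_gt0.
have h1 : 1 + x <= expR x by exact: expR_ge1Dx.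
case: (leP 0 x) => x0.
  have h2 : 1 - x <= expR (- x) by exact: expR_ge1Dx.
  have h3 : expR x * expR (- x) = 1 by rewrite expRxMexpNx_1.
  rewrite ger0_norm ?(ger0_norm x0); last lra.
  by nra.
rewrite ler0_norm ?(ltr0_norm x0); last by rewrite subr_le0 expR_le1 ltW.
by nra.
Qed.

(** [e^(x+iy) - 1 = (e^x - 1) + e^x (e^(iy) - 1)]. *)
Lemma ler_normc_cexp1 w : normc (cexp w - 1) <= 3 * normc w * (1 + expR (Re w)).
Proof.
have E0 : 0 < expR (Re w) by exact: expR_gt0.
rewrite (_ : cexp w - 1 = (expR (Re w) - 1)%:C +
  (expR (Re w))%:C * ((cos (Im w) - 1) +i* sin (Im w))); last first.
  by rewrite /cexp; apply: complexP; rewrite !(cReD, cImD, cReN, cImN, cReM, cImM)/=; ring.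
rewrite (le_trans (ler_normcD _ _))// Normc.normcM !normc_real (ger0_norm (ltW E0)).
have h1 := ler_norm_expR1 (Re w).
have h2 := ler_norm_sin (Im w).
have h3 := ler_norm_cos1 (Im w).
have h4 := ler_normc_ReIm ((cos (Im w) - 1) +i* sin (Im w)).
rewrite /= in h4.
have h5 := ler_norm_Re w; have h6 := ler_norm_Im w.
set N := normc _ in h4 *.
have : N <= 2 * normc w by rewrite (le_trans h4)//; lra.
have := normc_ge0 w.
have : 0 <= `|Re w| by [].
set E := expR _ in E0 h1 *; set W := normc w in h5 h6 *.
set A := `|Re w| in h1 h5 *.
move=> A0 W0 NW.
have : E * N <= E * (2 * W) by rewrite ler_pM2l.
have : A * (1 + E) <= W * (1 + E) by rewrite ler_wpM2r// addr_ge0// ltW.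
lra.
Qed.

Lemma ler_norm_ln u : 2^-1 <= u -> `|ln u| <= 2 * `|u - 1|.
Proof.
move=> u2; have u0 : 0 < u by apply: lt_le_trans u2.
case: (leP 1 u) => u1.
  rewrite ger0_norm ?ln_ge0// ger0_norm ?subr_ge0//.
  have : ln (1 + (u - 1)) <= u - 1 by apply: le_ln1Dx; lra.
  by rewrite subrKC; lra.
rewrite (ler0_norm (ln_le0 (ltW u1))) ltr0_norm ?subr_lt0//.
rewrite -lnV ?posrE//.
have : ln (1 + (u^-1 - 1)) <= u^-1 - 1.
  by apply: le_ln1Dx; rewrite ltrBrDl subrr invr_gt0.
rewrite subrKC => h; apply: (le_trans h).
rewrite -(ler_pM2r u0) mulrBl mulVf ?gt_eqF//.
by nra.
Qed.

(** For [u >= 1/2] this is the Lipschitz estimate of the exponential; for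
    [u < 1/2] the left-hand side is at most 2 while [`|u - 1|] is at least
    1/2. *)
Lemma cpow_near1 a : 0 < Re a -> exists C : R, exists K : nat, 0 < C /\
  forall u, 0 < u -> normc (cpow u%:C a - 1) <= C * `|u - 1| * (1 + u ^+ K).
Proof.
move=> a0; exists (12 * normc a + 4), (Num.truncn (Re a)).+1.
have na := normc_ge0 a.
have pow1 : 1 `^ Re a = 1 :> R by rewrite powR1.
split=> [|u u0]; first by lra.
set K := (Num.truncn _).+1.
have uK : u `^ Re a <= 1 + u ^+ K.
  case: (leP 1 u) => u1.
    rewrite -powR_mulrn; last exact: ltW.
    apply: (@le_trans _ _ (u `^ K%:R)); last by rewrite lerDr.
    by rewrite ler_powR//; apply: ltW; exact: truncnS_gt.
  apply: (@le_trans _ _ 1); last by rewrite lerDl exprn_ge0// ltW.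
  by rewrite -[leRHS]pow1 ge0_ler_powR// ?nnegrE//; apply: ltW.
have uK0 : 0 < u ^+ K by rewrite exprn_gt0.
case: (leP 2^-1 u) => u2.
- rewrite cpow_pos// (le_trans (ler_normc_cexp1 _))//.
  rewrite -normc_cexp -cpow_pos// normc_cpow// Normc.normcM normc_real.
  have := ler_norm_ln u2.
  have : 0 <= `|ln u| by [].
  have : 0 <= `|u - 1| by [].
  have : 0 < u `^ Re a by rewrite powR_gt0.
  move: uK uK0 na.
  set L := `|ln u|; set D := `|u - 1|; set P := u `^ _; set Q := u ^+ K; set A := normc a.
  move=> h1 h2 h3 h4 h5 h6 h7.
  have e1 : A * L <= A * (2 * D) by rewrite ler_wpM2l.
  have e2 : 3 * (A * L) * (1 + P) <= 3 * (A * (2 * D)) * (2 * (1 + Q)).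
    apply: ler_pM; [|lra|lra|lra].
    by rewrite mulr_ge0// mulr_ge0.
  have e3 : 0 <= D * (1 + Q) by rewrite mulr_ge0//; lra.
  lra.
- apply: (@le_trans _ _ 2).
    rewrite (le_trans (ler_normcB _ _))// normc1 normc_cpow//.
    suff : u `^ Re a <= 1 by lra.
    by rewrite -[leRHS]pow1 ge0_ler_powR// ?nnegrE//; lra.
  have : 2^-1 <= `|u - 1| by rewrite ltr0_norm; lra.
  set D := `|u - 1| => h.
  have : (12 * normc a + 4) * 2^-1 <= (12 * normc a + 4) * D by rewrite ler_wpM2l//; lra.
  set T := _ * D => h1.
  have T0 : 0 <= T by lra.
  have : 0 <= T * u ^+ K by rewrite mulr_ge0// ltW.
  lra.
Qed.

End PowerNearOne.

(** * Concentration of the Gamma and Beta weights *)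
Section GammaAsymptotics.
Context {R : realType}.
Implicit Types (a b : R[i]) (e t x y : R) (P : {poly R}).

(** The moment of order [j] of [u = t / (n+1)] under the probability density
    [t^n e^(-t) / n!] tends to 1. *)
Lemma moment_cvg j :
  ((n + j)`!%:R / (n`!%:R * n.+1%:R ^+ j) : R) @[n --> \oo] --> (1 : R).
Proof.
elim: j => [|j IH].
  rewrite (_ : (fun _ => _) = cst 1); first exact: cvg_cst.
  by apply/funext => n; rewrite addn0 expr0 mulr1 divff// pnatr_eq0 -lt0n fact_gt0.
rewrite (_ : (fun _ => _) = (fun n => (n + j)`!%:R / (n`!%:R * n.+1%:R ^+ j) *
   (1 + j%:R * harmonic n) : R)).
  rewrite -[X in _ --> X]mulr1; apply: cvgM => //.
  rewrite -[X in _ --> X]addr0; apply: cvgD; first exact: cvg_cst.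
  by rewrite -[X in _ --> X](mulr0 j%:R); apply: cvgMr; exact: cvg_harmonic.
apply/funext => n; rewrite addnS factS natrM exprS /harmonic/=.
rewrite (_ : (n + j).+1%:R = n.+1%:R + j%:R :> R); last by rewrite -natrD addSn.
have n0 : n.+1%:R != 0 :> R by rewrite pnatr_eq0.
have f0 : n`!%:R != 0 :> R by rewrite pnatr_eq0 -lt0n fact_gt0.
by field; rewrite f0 nat1r n0 expf_neq0.
Qed.

(** Hence that density concentrates at [u = 1]: the mean of a polynomial tends
    to its value at 1. *)
Lemma poly_moment_cvg P :
  (\sum_(i < size P) P`_i * ((n + i)`!%:R / (n`!%:R * n.+1%:R ^+ i)) : R)
    @[n --> \oo] --> (P.[1] : R).
Proof.
rewrite horner_coef.
have -> : \sum_(i < size P) P`_i * 1 ^+ i = \sum_(i < size P) P`_i * 1.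
  by apply: eq_bigr => i _; rewrite expr1n.
apply: cvg_big => [|i _]; first exact: add_continuous.
by apply: cvgMr; exact: moment_cvg.
Qed.

(** [P(t / (n+1)) t^n e^(-t)], written as a combination of Gamma integrands so
    that its integral is explicit. *)
Definition gamma_poly n P t : R[i] :=
  \sum_(i < size P) (P`_i / n.+1%:R ^+ i)%:C * gammaf (n.+1%:R + i%:R) t.

Lemma gamma_polyE n P t : 0 < t ->
  gamma_poly n P t = (P.[t / n.+1%:R] * expR (n%:R * ln t - t))%:C.
Proof.
move=> t0; have gE : gammaf n.+1%:R t = (expR (n%:R * ln t - t))%:C :> R[i].
  have -> : n%:R * ln t - t = Re ((n%:R : R[i]) * (ln t)%:C - t%:C).
    by rewrite natC -rmorphM -rmorphB.
  rewrite /gammaf -natr1 addrK natC -rmorphM -rmorphB; exact: cexp_real.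
rewrite /gamma_poly horner_coef big_distrl/= rmorph_sum/=; apply: eq_bigr => i _.
rewrite gammafDn// gE (_ : t%:C ^+ i = (t ^+ i)%:C); last by rewrite rmorphXn.
rewrite -!rmorphM/=; congr (_ %:C).
by rewrite expr_div_n; ring.
Qed.

Lemma gamma_poly_integrable n P : cintegrable `]0, +oo[ (gamma_poly n P).
Proof.
apply: cintegrable_sum => // i; apply: cintegrableZ => //.
by apply: gammaf_integrable; apply: Re_gt0_addn; rewrite cReMn_nat.
Qed.

Lemma gamma_poly_integral n P :
  (\int[mu]_(t in `]0%R, +oo[) Re (gamma_poly n P t))%R =
  n`!%:R * \sum_(i < size P) P`_i * ((n + i)`!%:R / (n`!%:R * n.+1%:R ^+ i)) :> R.
Proof.
have n0 i : 0 < Re (n.+1%:R + i%:R : R[i]).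
  by apply: Re_gt0_addn; rewrite cReMn_nat.
rewrite -[LHS]/(Re (cintegral `]0, +oo[ (gamma_poly n P))) /gamma_poly.
rewrite cintegral_sum//; last first.
  by move=> i; apply: cintegrableZ => //; exact: gammaf_integrable.
rewrite (eq_bigr (fun i : 'I__ => (P`_i / n.+1%:R ^+ i * (n + i)`!%:R)%:C)); last first.
  move=> i _; rewrite cintegralZ//; last exact: gammaf_integrable.
  rewrite -GammaE// -natrD addSn Gamma_nat natC.
  by rewrite [RHS]rmorphM.
rewrite -rmorph_sum/= big_distrr/=; apply: eq_bigr => i _.
have f0 : n`!%:R != 0 :> R by rewrite pnatr_eq0 -lt0n fact_gt0.
have n1 : n.+1%:R != 0 :> R by rewrite pnatr_eq0.
by field; rewrite f0 expf_neq0.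
Qed.

(** With [u = t / (n+1)], [Gamma (a+n+1) / (n+1)^a - n!] is the integral of
    [(u^a - 1) t^n e^(-t)].  By [cpow_near1] and the inequality
    [z <= d + z^2 / (4 d)] the factor [u^a - 1] is dominated by a polynomial in
    [u] whose value at 1 is the arbitrarily small [d]. *)
Lemma Gamma_asymp a : 0 < Re a ->
  ((Gamma (a + n.+1%:R) / (n`!%:R * cpow (n.+1%:R)%:C a) : R[i]^o))
    @[n --> \oo] --> (1 : R[i]^o).
Proof.
move=> a0; apply/ccvgP => e e0.
have [C [K [C0 CP]]] := cpow_near1 a0.
(* The final bound is 2 * M with M < 2 * d, hence less than e. *)
pose d := e / 8; have d0 : 0 < d by rewrite divr_gt0.
pose P : {poly R} := d%:P + (C ^+ 2 / (4 * d)) *: (('X - 1) ^+ 2 * (1 + 'X^K) ^+ 2).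
have P1 : P.[1] = d.
  rewrite /P hornerD hornerC hornerZ hornerM !horner_exp hornerD hornerN hornerX.
  by rewrite hornerC subrr expr0n/= mul0r mulr0 addr0.
have := @poly_moment_cvg P; rewrite P1 => /cvgrPdist_lt /(_ d d0).
apply: filterS => n; set M := \sum_(i < _) _ => Md.
have N0 : 0 < n.+1%:R :> R by [].
have fn0 : n`!%:R != 0 :> R[i] by rewrite pnatr_eq0 -lt0n fact_gt0.
have nR : 0 < Re (n.+1%:R : R[i]) by rewrite cReMn_nat.
have aR : 0 < Re (a + n.+1%:R) by apply: Re_gt0_addn.
have cN := cpow_neq0 a N0.
set c := cpow (n.+1%:R)%:C a.
rewrite (_ : 1 - _ = - ((n`!%:R)^-1 * (c^-1 * Gamma (a + n.+1%:R) - n`!%:R))); last first.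
  by field; rewrite cN fn0.
rewrite normcN Normc.normcM Normc.normcV normc_nat.
rewrite -Gamma_nat !GammaE//.
have i1 := gammaf_integrable aR; have i2 := gammaf_integrable nR.
rewrite -cintegralZ// -cintegralB//; last exact: cintegrableZ.
apply: (@le_lt_trans _ _ (n`!%:R^-1 * (2 * (n`!%:R * M)))).
  rewrite ler_pM2l ?invr_gt0 ?ltr0n ?fact_gt0//.
  rewrite -gamma_poly_integral; apply: ler_normc_cintegral => //.
  - by apply: cintegrableB => //; exact: cintegrableZ.
  - by have [] := gamma_poly_integrable n P.
  - move=> t /=; rewrite in_itv/= andbT => t0.
    rewrite gamma_polyE//.
    set u := t / n.+1%:R; have u0 : 0 < u by rewrite divr_gt0.
    rewrite [X in normc X](_ : _ = (cpow u%:C a - 1) * gammaf n.+1%:R t); last first.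
      rewrite mulrBl mul1r; congr (_ - _).
      have -> : gammaf (a + n.+1%:R) t = cpow t%:C a * gammaf n.+1%:R t.
        rewrite !gammafE// -[a + _ - 1]addrA.
        by rewrite (cpowD a)// mulrA.
      have -> : cpow t%:C a = c * cpow u%:C a.
        by rewrite -cpowM//; congr (cpow _%:C a); rewrite /u mulrCA divff ?mulr1.
      by rewrite !mulrA mulVf// mul1r.
    rewrite Normc.normcM normc_gammaf cReMn_nat -natr1 addrK.
    rewrite -[Re _]/(_ * _) ler_wpM2r ?expR_ge0//.
    rewrite (le_trans (CP u u0))// /P hornerD hornerC hornerZ hornerM !horner_exp.
    rewrite !hornerD hornerN hornerX hornerXn !hornerC.
    set X := u - 1; set Y := 1 + u ^+ K.
    have Y0 : 0 < Y by rewrite addr_gt0// exprn_gt0.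
    have -> : X ^+ 2 = `|X| ^+ 2 by rewrite real_normK ?num_real.
    set Z := C * `|X| * Y.
    have -> : C ^+ 2 / (4 * d) * (`|X| ^+ 2 * Y ^+ 2) = Z ^+ 2 / (4 * d).
      by rewrite /Z; ring.
    (* Z <= d + Z ^+ 2 / (4 * d), by completing the square *)
    have : 0 <= (Z - 2 * d) ^+ 2 / (4 * d) by rewrite divr_ge0 ?sqr_ge0// mulr_ge0// ltW.
    have -> : (Z - 2 * d) ^+ 2 / (4 * d) = Z ^+ 2 / (4 * d) - Z + d.
      by field; rewrite gt_eqF.
    lra.
rewrite mulrCA mulKf ?pnatr_eq0 -?lt0n ?fact_gt0//.
move: Md; rewrite ltr_norml /d => /andP[h1 h2]; lra.
Qed.

(** The same argument at [t = 1/2]: [(2t)^a (2-2t)^b - 1] is at most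
    [C `|2t - 1|], hence at most [d + C^2 (2t-1)^2 / (4 d)], and the integral of
    [(2t-1)^2 = 1 - 4 t (1-t)] against [t^n (1-t)^n] is the total mass divided
    by [2n + 3], by the recurrences of the Beta integral. *)
Lemma Bint_asymp a b : 0 < Re a -> 0 < Re b ->
  ((Bint (a + n.+1%:R) (b + n.+1%:R) * cpow (2 : R)%:C (a + b) /
    Bint n.+1%:R n.+1%:R : R[i]^o))
    @[n --> \oo] --> (1 : R[i]^o).
Proof.
move=> a0 b0; apply/ccvgP => e e0.
have [C1 [K1 [C10 CP1]]] := cpow_near1 a0.
have [C2 [K2 [C20 CP2]]] := cpow_near1 b0.
pose C := C1 * (1 + 2 ^+ K1) * 2 `^ Re b + C2 * (1 + 2 ^+ K2).
have C0 : 0 < C.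
  by rewrite addr_gt0 ?mulr_gt0 ?powR_gt0 ?addr_gt0 ?exprn_gt0.
pose d := e / 8; have d0 : 0 < d by rewrite divr_gt0.
have B t : 0 < t < 1 ->
    normc (cpow (2 * t)%:C a * cpow (2 * (1 - t))%:C b - 1) <= C * `|2 * t - 1|.
  move=> /andP[t0 t1].
  have t20 : 0 < 2 * t by rewrite mulr_gt0.
  have t21 : 0 < 2 * (1 - t) by rewrite mulr_gt0 ?subr_gt0.
  have bnd1 k u : 0 < u -> u <= 2 -> u ^+ k <= 2 ^+ k :> R.
    by move=> u0 u2; rewrite lerXn2r ?nnegrE// ltW.
  set f := cpow _ a; set g := cpow _ b.
  rewrite (_ : f * g - 1 = (f - 1) * g + (g - 1)); last by ring.
  rewrite (le_trans (ler_normcD _ _))// Normc.normcM /C mulrDl lerD//.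
  - rewrite mulrAC; apply: ler_pM; rewrite ?normc_ge0//.
      rewrite (le_trans (CP1 _ t20))// mulrAC ler_wpM2r// ler_wpM2l ?(ltW C10)//.
      by rewrite lerD2l bnd1//; lra.
    rewrite /g normc_cpow// ge0_ler_powR ?nnegrE//; [exact: ltW|exact: ltW|lra].
  - rewrite (le_trans (CP2 _ t21))// (_ : `|2 * (1 - t) - 1| = `|2 * t - 1|).
      rewrite mulrAC ler_wpM2r// ler_wpM2l ?(ltW C20)//.
      by rewrite lerD2l bnd1//; lra.
    by rewrite -normrN; congr `|_|; ring.
have Q0 : 0 < C ^+ 2 / (4 * d) by rewrite divr_gt0 ?exprn_gt0// mulr_gt0.
have : \forall n \near \oo, C ^+ 2 / (4 * d) / d < n%:R by exact: nbhs_infty_gtr.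
apply: filterS => n nlarge.
have nR : 0 < Re (n.+1%:R : R[i]) by rewrite cReMn_nat.
have nR1 : 0 < Re (n.+1%:R + 1%:R : R[i]) by apply: Re_gt0_addn.
have aR : 0 < Re (a + n.+1%:R) by apply: Re_gt0_addn.
have bR : 0 < Re (b + n.+1%:R) by apply: Re_gt0_addn.
pose bn : R := n`!%:R ^+ 2 / (n + n).+1`!%:R.
have bn0 : 0 < bn by rewrite divr_gt0 ?exprn_gt0 ?ltr0n ?fact_gt0.
have BE : Bint n.+1%:R n.+1%:R = bn%:C :> R[i].
  by rewrite BintS /bn !natC rmorphM rmorphXn/= fmorphV.
have BE1 : Bint (n.+1%:R + 1%:R) (n.+1%:R + 1%:R) =
    (bn * (n.+1%:R / (2 * (n.+1 + n.+1).+1%:R)))%:C :> R[i].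
  have := BintDn 1 1 nR nR.
  rewrite BE !pochhammerSr !pochhammer0 !mul1r !addr0 -!natrD addn1 => E.
  have m0 : (n.+1 + n.+1)%:R * (n.+1 + n.+1).+1%:R != 0 :> R[i].
    by rewrite mulf_neq0// pnatr_eq0.
  apply: (mulfI m0); rewrite E !natC -!rmorphM/=; congr (_ %:C).
  rewrite !natrM -[(n.+1 + n.+1).+1%:R]natr1 natrD.
  have : 0 < n.+1%:R :> R by [].
  move: (n.+1%:R : R) => x x0; field.
  by rewrite gt_eqF//; lra.
have i1 := betaf_integrable aR bR; have i2 := betaf_integrable nR nR.
have i3 := betaf_integrable nR1 nR1.
pose c := cpow (2 : R)%:C (a + b).
have bC : bn%:C != 0 :> R[i] by rewrite (inj_eq (@complexI _)) gt_eqF.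
rewrite BE (_ : 1 - _ = - (bn^-1%:C * (c * Bint (a + n.+1%:R) (b + n.+1%:R) - bn%:C))); last first.
  by rewrite fmorphV/= /c; field; exact: bC.
rewrite normcN Normc.normcM normc_ge0_real ?invr_ge0 ?(ltW bn0)//.
rewrite -BE -cintegralZ// -cintegralB//; last exact: cintegrableZ.
pose h t := (d%:C * betaf n.+1%:R n.+1%:R t + (C ^+ 2 / (4 * d))%:C *
  (betaf n.+1%:R n.+1%:R t - 4 * betaf (n.+1%:R + 1%:R) (n.+1%:R + 1%:R) t) : R[i]).
have i4 : cintegrable `]0, 1[ (fun t => 4 * betaf (n.+1%:R + 1%:R : R[i]) (n.+1%:R + 1%:R) t).
  exact: cintegrableZ.
have i5 : cintegrable `]0, 1[ (fun t =>
    betaf (n.+1%:R : R[i]) n.+1%:R t - 4 * betaf (n.+1%:R + 1%:R) (n.+1%:R + 1%:R) t).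
  exact: cintegrableB.
have i6 : cintegrable `]0, 1[ (fun t => (C ^+ 2 / (4 * d))%:C *
    (betaf (n.+1%:R : R[i]) n.+1%:R t - 4 * betaf (n.+1%:R + 1%:R) (n.+1%:R + 1%:R) t)).
  exact: cintegrableZ.
have i7 : cintegrable `]0, 1[ (fun t => d%:C * betaf (n.+1%:R : R[i]) n.+1%:R t).
  exact: cintegrableZ.
have ih : cintegrable `]0, 1[ h by exact: cintegrableD.
have hE : (\int[mu]_(t in `]0%R, 1%R[) Re (h t))%R =
    bn * (d + C ^+ 2 / (4 * d) * (1 - 4 * (n.+1%:R / (2 * (n.+1 + n.+1).+1%:R)))).
  rewrite -[LHS]/(Re (cintegral `]0, 1[ h)) /h.
  rewrite cintegralD// !cintegralZ// cintegralB// !cintegralZ//.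
  rewrite -!/(Bint _ _) BE BE1.
  rewrite (_ : 4 = (4 : R)%:C); last by rewrite rmorph_nat.
  by rewrite -!(rmorphM, rmorphB, rmorphD)/=; ring.
apply: (@le_lt_trans _ _ (bn^-1 * (2 * (bn * (d + C ^+ 2 / (4 * d) *
    (1 - 4 * (n.+1%:R / (2 * (n.+1 + n.+1).+1%:R)))))))).
  rewrite ler_pM2l ?invr_gt0// -hE; apply: ler_normc_cintegral => //.
  - by apply: cintegrableB => //; exact: cintegrableZ.
  - by have [] := ih.
  - move=> t tI; have t01 : 0 < t < 1 by move: tI; rewrite /= in_itv.
    have /andP[t0 t1] := t01.
    have t10 : 0 < 1 - t by rewrite subr_gt0.
    pose w := expR (n%:R * ln t + n%:R * ln (1 - t)).
    have bE : betaf n.+1%:R n.+1%:R t = w%:C :> R[i].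
      rewrite /betaf /w -cexp_real rmorphD !rmorphM/= -natC.
      by rewrite -natr1 addrK.
    rewrite [X in normc X](_ : _ =
      (cpow (2 * t)%:C a * cpow (2 * (1 - t))%:C b - 1) * w%:C); last first.
      rewrite mulrBl mul1r -bE; congr (_ - _).
      rewrite !betafE// (_ : 1 - t%:C = (1 - t)%:C); last by rewrite rmorphB.
      rewrite -![_ + n.+1%:R - 1]addrA !cpowD// !cpowM// /c cpowD//; ring.
    have w0 : 0 < w by exact: expR_gt0.
    rewrite /h (betafDn n.+1%:R n.+1%:R 1 1 t01) bE !expr1 Normc.normcM (normc_ge0_real (ltW w0)).
    rewrite (_ : Re _ = (d + C ^+ 2 / (4 * d) * (2 * t - 1) ^+ 2) * w); last first.
      rewrite (_ : 4 = (4 : R)%:C); last by rewrite rmorph_nat.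
      by rewrite -!(rmorphM, rmorphB, rmorphD)/=; ring.
    rewrite ler_pM2r// (le_trans (B _ t01))//.
    rewrite -[(2 * t - 1) ^+ 2]real_normK ?num_real//.
    set Z := C * _.
    rewrite (_ : C ^+ 2 / (4 * d) * _ = Z ^+ 2 / (4 * d)); last by rewrite /Z; ring.
    (* Z <= d + Z ^+ 2 / (4 * d), by completing the square *)
    have : 0 <= (Z - 2 * d) ^+ 2 / (4 * d) by rewrite divr_ge0 ?sqr_ge0// mulr_ge0// ltW.
    have -> : (Z - 2 * d) ^+ 2 / (4 * d) = Z ^+ 2 / (4 * d) - Z + d.
      by field; rewrite gt_eqF.
    lra.
rewrite mulrCA mulKf ?gt_eqF//.
have n10 : 0 < n%:R :> R by apply: le_lt_trans nlarge; rewrite ltW// divr_gt0.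
have -> : 1 - 4 * (n.+1%:R / (2 * (n.+1 + n.+1).+1%:R)) = (n.+1 + n.+1).+1%:R^-1 :> R.
  rewrite -[(n.+1 + n.+1).+1%:R]natr1 natrD.
  have : 0 < n.+1%:R :> R by [].
  by move: (n.+1%:R : R) => x x0; field; rewrite gt_eqF//; lra.
suff : C ^+ 2 / (4 * d) * (n.+1 + n.+1).+1%:R^-1 < d.
  by set X := _ * _; rewrite /d => hX; lra.
rewrite ltr_pdivrMr// [d * _]mulrC -ltr_pdivrMr//.
apply: (lt_trans nlarge); rewrite ltr_nat ltnS.
by rewrite (leq_trans (leqnSn n))// leq_addr.
Qed.

End GammaAsymptotics.

(** * The Beta integral in terms of Gamma *)
Section BetaGamma.
Context {R : realType}.
Implicit Types (a b : R[i]).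

(** Let [Q] and [S] be the left and right sides of the second claim.  The
    recurrences and the two asymptotic formulas show that [r n * S] and
    [r n * Q] tend to 1 for the same sequence [r], so [S] is nonzero and, computing the limit of
    [r n * S * Q] in two ways, equal to [Q]. *)
Lemma Bint_Gamma_neq0 a b : 0 < Re a -> 0 < Re b ->
  Gamma a * Gamma b != 0 /\ Bint a b * Gamma (a + b) = Gamma a * Gamma b.
Proof.
move=> a0 b0; have ab0 : 0 < Re (a + b) by rewrite cReD addr_gt0.
set S := Gamma a * Gamma b; set Q := Bint a b * Gamma (a + b).
pose W (n : nat) : R[i] := n`!%:R ^+ 2 * cpow (n.+1%:R)%:C (a + b).
pose r (n : nat) : R[i]^o := pochhammer a n.+1 * pochhammer b n.+1 / W n.
have fn0 n : n`!%:R != 0 :> R[i] by rewrite pnatr_eq0 -lt0n fact_gt0.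
have cn0 c n : cpow (n.+1%:R)%:C c != 0 by rewrite cpow_neq0.
have rS : r n * (S : R[i]^o) @[n --> \oo] --> (1 : R[i]^o).
  pose g c (n : nat) : R[i]^o := Gamma (c + n.+1%:R) / (n`!%:R * cpow (n.+1%:R)%:C c).
  rewrite (_ : (fun n => _) = (fun n => g a n * g b n)).
    by rewrite -[X in _ --> X]mulr1; apply: cvgM; exact: Gamma_asymp.
  apply/funext => n; rewrite /g.
  rewrite !GammaDn// /r /W cpowD//.
  have key (pa pb Ga Gb f ca cb : R[i]) : f != 0 -> ca != 0 -> cb != 0 ->
      pa * pb / (f ^+ 2 * (ca * cb)) * (Ga * Gb) =
      pa * Ga / (f * ca) * (pb * Gb / (f * cb)).
    by move=> h1 h2 h3; field; rewrite h1 h2 h3.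
  exact: key.
have rQ : r n * (Q : R[i]^o) @[n --> \oo] --> (1 : R[i]^o).
  have H := Gamma_asymp ab0.
  have H2 : (Gamma (a + b + (n.*2.+1).+1%:R) /
      ((n.*2.+1)`!%:R * cpow ((n.*2.+1).+1%:R)%:C (a + b)) : R[i]^o)
      @[n --> \oo] --> (1 : R[i]^o).
    apply: (cvg_comp (fun n => n.*2.+1) _ _ H).
    move=> A [N _ NA]; exists N => // m /= Nm; apply: NA => /=; lia.
  pose g (n : nat) : R[i]^o := Gamma (a + b + (n.*2.+1).+1%:R) /
    ((n.*2.+1)`!%:R * cpow ((n.*2.+1).+1%:R)%:C (a + b)).
  pose h (n : nat) : R[i]^o := Bint (a + n.+1%:R) (b + n.+1%:R) *
    cpow (2 : R)%:C (a + b) / Bint n.+1%:R n.+1%:R.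
  rewrite (_ : (fun n => _) = (fun n => h n * g n)).
    by rewrite -[X in _ --> X]mulr1; apply: cvgM => //; exact: Bint_asymp.
  apply/funext => n; rewrite /g /h.
  have -> : (n.*2.+1).+1 = (n.+1 + n.+1)%N by lia.
  have -> : (n.*2.+1) = (n + n).+1%N by lia.
  have B := BintDn n.+1 n.+1 a0 b0.
  have p0 := pochhammer_neq0 (n.+1 + n.+1) ab0.
  have -> : Bint (a + n.+1%:R) (b + n.+1%:R) =
      pochhammer a n.+1 * pochhammer b n.+1 * Bint a b / pochhammer (a + b) (n.+1 + n.+1).
    by rewrite -B mulrAC divff// mul1r.
  rewrite GammaDn// BintS /r /W.
  have -> : (n.+1 + n.+1)%:R = 2 * n.+1%:R :> R by rewrite natrD; ring.
  rewrite cpowM//; set c2 := cpow _ _.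
  have c20 : c2 != 0 by exact: cpow_neq0.
  have key (pa pb pab B2 Gab f f2 c1 c : R[i]) :
      f != 0 -> f2 != 0 -> c1 != 0 -> c != 0 -> pab != 0 ->
      pa * pb / (f ^+ 2 * c) * (B2 * Gab) =
      pa * pb * B2 / pab * c1 / (f ^+ 2 / f2) * (pab * Gab / (f2 * (c1 * c))).
    by move=> h1 h2 h3 h4 h5; field; rewrite h1 h2 h3 h4 h5.
  exact: key.
have S0 : S != 0.
  apply/eqP => S0; move: rS; rewrite S0; under eq_fun do rewrite mulr0.
  move=> /cvg_lim => /(_ (@norm_hausdorff _ _)).
  by rewrite lim_cst// => /esym/eqP; rewrite oner_eq0.
split => //.
have cS : (fun _ : nat => (S : R[i]^o)) @ \oo --> (S : R[i]^o) by exact: cvg_cst.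
have cQ : (fun _ : nat => (Q : R[i]^o)) @ \oo --> (Q : R[i]^o) by exact: cvg_cst.
have h1 : r n * S * Q @[n --> \oo] --> (1 * Q : R[i]^o) by exact: (cvgM rS cQ).
have h2 : r n * S * Q @[n --> \oo] --> (1 * S : R[i]^o).
  under eq_fun do rewrite mulrAC.
  exact: (cvgM rQ cS).
apply: (mulfI (oner_neq0 R[i])); exact: (cvg_unique (@norm_hausdorff _ _) h1 h2).
Qed.

Lemma Gamma_neq0 a : 0 < Re a -> Gamma a != 0.
Proof.
by move=> a0; have [+ _] := Bint_Gamma_neq0 a0 a0; rewrite mulf_eq0 orbb.
Qed.

Lemma BetaE a b : 0 < Re a -> 0 < Re b -> Beta a b = Bint a b.
Proof.
move=> a0 b0; have [_ E] := Bint_Gamma_neq0 a0 b0.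
by rewrite /Beta -E mulfK// Gamma_neq0// cReD addr_gt0.
Qed.

Lemma Bint_neq0 a b : 0 < Re a -> 0 < Re b -> Bint a b != 0.
Proof.
move=> a0 b0; have [+ E] := Bint_Gamma_neq0 a0 b0.
by rewrite -E mulf_eq0 negb_or => /andP[].
Qed.

(** Restrict the Euler integral to [[M, M+1]]. *)
Lemma Gamma_real_lb (s M : R) : 0 <= s -> 0 < M ->
  expR (s * ln M - (M + 1)) <= normc (Gamma (s + 1)%:C).
Proof.
move=> s0 M0; have sR : 0 < Re (s + 1)%:C by rewrite /= ltr_wpDl.
rewrite GammaE// (le_trans _ (ler_norm_Re _))// (le_trans _ (ler_norm _))//.
rewrite -[leRHS]/(\int[lebesgue_measure]_(t in `]0%R, +oo[) Re (gammaf (s + 1)%:C t))%R.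
have [i1 _] := gammaf_integrable sR.
have E t : Re (gammaf (s + 1)%:C t) = expR (s * ln t - t).
  rewrite /gammaf (_ : _ - _ = (s * ln t - t)%:C) ?cexp_real//.
  by rewrite rmorphD/= addrK rmorphB rmorphM.
rewrite -lee_fin /Rintegral fineK; last exact: integrable_fin_num.
have := @lebesgue_measure_itv R (`[M, M + 1]).
rewrite /= lte_fin ltrDl ltr01 -EFinB addrAC subrr add0r => mM.
have sub : (`[M, M + 1] `<=` `]0, +oo[)%classic.
  by move=> t /=; rewrite !in_itv/= andbT => /andP[+ _]; apply: lt_le_trans.
apply: (@le_trans _ _ (\int[lebesgue_measure]_(t in `[M, (M + 1)%R])
    (Re (gammaf (s + 1)%:C t))%:E)%E); last first.
  apply: ge0_subset_integral => //; first by case/integrableP : i1.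
  by move=> t _; rewrite lee_fin E expR_ge0.
apply: (@le_trans _ _ (\int[lebesgue_measure]_(t in `[M, (M + 1)%R])
    (cst (expR (s * ln M - (M + 1))%R)%:E) t)%E).
  by rewrite integral_cst// [X in (_ * X)%E](_ : _ = 1%E) ?mule1.
have M0t t : M <= t -> 0 < t by apply: lt_le_trans.
apply: ge0_le_integral => //.
- by move=> t _; rewrite lee_fin expR_ge0.
- by apply: measurable_funS (measurable_int _ i1) => //.
- move=> t tI; have /andP[Mt tM] : M <= t <= M + 1 by move: tI; rewrite /= in_itv.
  rewrite lee_fin E ler_expR.
  by apply: lerB => //; rewrite ler_wpM2l// ler_ln ?posrE ?M0t.
Qed.

End BetaGamma.

(** * The binomial series with complex exponent *)
Section BinomialSeries.
Context {R : realType}.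
Implicit Types (a x z : R[i]) (t s q e : R).

(** On the right half-plane the principal argument is the arctangent of the
    slope; unlike the arccosine this formula is differentiable across the
    positive real axis. *)
Lemma clog_Re_gt0 z : 0 < Re z ->
  clog z = (2^-1 * ln (Re z ^+ 2 + Im z ^+ 2)) +i* atan (Im z / Re z).
Proof.
case: z => f g /= f0; rewrite /clog /carg /=.
have q0 : 0 < f ^+ 2 + g ^+ 2 by rewrite ltr_pwDl ?exprn_gt0// sqr_ge0.
congr (_ +i* _).
  by rewrite -powR12_sqrt ?ltW// ln_powR.
have cosE : cos (atan (g / f)) = f / Num.sqrt (f ^+ 2 + g ^+ 2).
  rewrite cos_atan.
  have -> : 1 + (g / f) ^+ 2 = (f ^+ 2 + g ^+ 2) * (f^-1) ^+ 2.
    by field; rewrite gt_eqF.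
  rewrite sqrtrM ?ltW// sqrtr_sqr gtr0_norm ?invr_gt0// invfM invrK mulrC.
  by [].
rewrite -cosE; have hpi := atan_ltpi2 (g / f); have hpi' := atan_gtNpi2 (g / f).
have pi0 : 0 < pi :> R by exact: pi_gt0.
case: ifPn => [g0|]; last rewrite -ltNge => g0.
- have t0 : 0 <= atan (g / f).
    by rewrite -[X in X <= _]atan0 le_atan// divr_ge0// ltW.
  by rewrite cosK// in_itv/= t0/=; lra.
- have t0 : atan (g / f) <= 0.
    by rewrite -[X in _ <= X]atan0 le_atan// ltW// pmulr_llt0// invr_gt0.
  by rewrite -cosN cosK ?opprK// in_itv/= oppr_ge0 t0/=; lra.
Qed.

(** The principal logarithm of [1 - x t], in the form given by
    [clog_Re_gt0]. *)
Definition log_onesub x t : R[i] :=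
  (2^-1 * ln ((1 - Re x * t) ^+ 2 + (Im x * t) ^+ 2)) +i*
  atan (- (Im x * t) / (1 - Re x * t)).

Lemma Re_onesub_gt0 x t : normc x < 1 -> 0 <= t <= 1 -> 0 < 1 - Re x * t.
Proof.
move=> x1 /andP[t0 t1]; have := ler_norm_Re x; rewrite ler_norml => /andP[_ h].
rewrite subr_gt0; apply: le_lt_trans x1.
have := normc_ge0 x; nra.
Qed.

Lemma onesubE x t : 1 - x * t%:C = (1 - Re x * t) +i* (- (Im x * t)) :> R[i].
Proof. by apply: complexP; rewrite !(cReD, cImD, cReN, cImN, cReM, cImM)/=; ring. Qed.

Lemma clog_onesub x t : normc x < 1 -> 0 <= t <= 1 -> clog (1 - x * t%:C) = log_onesub x t.
Proof.
move=> x1 t01; rewrite onesubE clog_Re_gt0/= ?Re_onesub_gt0// /log_onesub.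
by rewrite sqrrN.
Qed.

Lemma cpow_onesub x t a : normc x < 1 -> 0 <= t <= 1 ->
  cpow (1 - x * t%:C) a = cexp (a * log_onesub x t).
Proof.
move=> x1 t01; rewrite /cpow ifF ?clog_onesub//.
apply: negbTE; rewrite onesubE; apply/eqP => /(congr1 (@complex.Re R)) /= E.
by have := Re_onesub_gt0 x1 t01; rewrite E ltxx.
Qed.

Lemma is_cderive_log_onesub x t : normc x < 1 -> 0 <= t <= 1 ->
  is_cderive (log_onesub x) t (- x / (1 - x * t%:C)).
Proof.
move=> x1 t01; have f0 := Re_onesub_gt0 x1 t01.
have q0 : 0 < (1 - Re x * t) ^+ 2 + (Im x * t) ^+ 2.
  by rewrite ltr_pwDl ?exprn_gt0// sqr_ge0.
rewrite onesubE.
have invE : ((1 - Re x * t) +i* (- (Im x * t)))^-1 =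
    ((1 - Re x * t) / ((1 - Re x * t) ^+ 2 + (Im x * t) ^+ 2)) +i*
    (Im x * t / ((1 - Re x * t) ^+ 2 + (Im x * t) ^+ 2)) :> R[i].
  by rewrite -[LHS]/(_ +i* _) sqrrN mulNr opprK.
have fD : is_derive t 1 (fun s => 1 - Re x * s) (- Re x).
  apply: is_derive_eq; rewrite /GRing.scale/=; ring.
have gD : is_derive t 1 (fun s => Im x * s) (Im x).
  apply: is_derive_eq; rewrite /GRing.scale/=; ring.
set f := fun s => 1 - Re x * s in fD *; set g := fun s => Im x * s in gD *.
have qD : is_derive t 1 (f ^+ 2 + g ^+ 2) (2 * (f t * (- Re x) + g t * Im x)).
  apply: is_derive_eq; rewrite /GRing.scale/=; ring.
split; rewrite /log_onesub/= invE.
- rewrite cReM /= cReN cImN.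
  have lD : is_derive t 1 (@ln R \o (f ^+ 2 + g ^+ 2))
      ((f t ^+ 2 + g t ^+ 2)^-1 * (2 * (f t * (- Re x) + g t * Im x))).
    by apply: is_derive1_comp; exact: is_derive1_ln.
  have lD2 : is_derive t 1 (fun s => 2^-1 * (@ln R \o (f ^+ 2 + g ^+ 2)) s)
      (2^-1 * ((f t ^+ 2 + g t ^+ 2)^-1 * (2 * (f t * (- Re x) + g t * Im x)))).
    exact: is_deriveZ.
  apply: (is_derive_eq lD2); rewrite /f /g; field.
  by rewrite gt_eqF.
- rewrite cImM /= cReN cImN.
  have iD : is_derive t 1 (fun s => (f s)^-1) (- (f t) ^- 2 * (- Re x)).
    by apply: is_deriveV => //; rewrite gt_eqF.
  have vD : is_derive t 1 (fun s => - g s * (f s)^-1)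
      (- Im x * (f t)^-1 + - g t * (- (f t) ^- 2 * (- Re x))).
    apply: is_derive_eq; rewrite /GRing.scale/=; ring.
  have aD : is_derive t 1 (@atan R \o (fun s => - g s * (f s)^-1))
      ((1 + (- g t * (f t)^-1) ^+ 2)^-1 * (- Im x * (f t)^-1 + - g t * (- (f t) ^- 2 * (- Re x)))).
    by apply: is_derive1_comp.
  apply: (is_derive_eq aD); rewrite /f /g; field.
  rewrite !gt_eqF//.
Qed.

Definition binom_coef a x (m : nat) : R[i] := pochhammer a m / m`!%:R * x ^+ m.

Lemma binom_coef0 a x : binom_coef a x 0 = 1.
Proof. by rewrite /binom_coef pochhammer0 expr0 fact0 divr1 mulr1. Qed.

Lemma factC_neq0 n : n`!%:R != 0 :> R[i].
Proof. by rewrite pnatr_eq0 -lt0n fact_gt0. Qed.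

Lemma binom_coefS a x m : m.+1%:R * binom_coef a x m.+1 = (a + m%:R) * x * binom_coef a x m.
Proof.
rewrite /binom_coef pochhammerSr factS natrM exprS.
have m0 : m.+1%:R != 0 :> R[i] by rewrite pnatr_eq0.
have f0 := factC_neq0 m.
by field; rewrite f0 nat1r m0.
Qed.

Lemma binom_coefS1 a x m : m.+1%:R * binom_coef a x m.+1 = a * x * binom_coef (a + 1) x m.
Proof.
rewrite /binom_coef pochhammerSl factS natrM exprS.
have m0 : m.+1%:R != 0 :> R[i] by rewrite pnatr_eq0.
have f0 := factC_neq0 m.
by field; rewrite f0 nat1r m0.
Qed.

(** The ratio of consecutive coefficients is [(a+m) x / (m+1)], whose modulus
    is eventually at most [q]. *)
Lemma binom_coef_geometric a x q : normc x < q -> exists C : R, 0 < C /\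
  forall m, normc (binom_coef a x m) <= C * q ^+ m.
Proof.
move=> xq; have x0 := normc_ge0 x; have q0 : 0 < q by apply: le_lt_trans xq.
have na := normc_ge0 a.
pose M := (Num.truncn (normc a * normc x / (q - normc x))).+1.
have qx : 0 < q - normc x by rewrite subr_gt0.
have step m : (M <= m)%N ->
    normc (binom_coef a x m.+1) <= q * normc (binom_coef a x m).
  move=> Mm; have m0 : 0 < m.+1%:R :> R by [].
  rewrite -(ler_pM2l m0) -[m.+1%:R in X in X <= _]normc_nat -Normc.normcM binom_coefS.
  rewrite 2!Normc.normcM [leRHS]mulrA; apply: ler_wpM2r; first exact: normc_ge0.
  have h1 : normc (a + m%:R) <= normc a + m%:R.
    by rewrite (le_trans (ler_normcD _ _))// normc_nat.
  have h2 : normc a * normc x <= m%:R * (q - normc x).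
    rewrite -ler_pdivrMr//; apply: ltW; apply: (lt_le_trans (truncnS_gt _)).
    by rewrite ler_nat.
  have h3 : normc (a + m%:R) * normc x <= (normc a + m%:R) * normc x.
    by rewrite ler_wpM2r.
  by rewrite -natr1; lra.
pose C := 1 + \sum_(m < M.+1) normc (binom_coef a x m) / q ^+ m.
have S0 : 0 <= \sum_(m < M.+1) normc (binom_coef a x m) / q ^+ m.
  by apply: sumr_ge0 => i _; rewrite divr_ge0 ?normc_ge0// exprn_ge0// ltW.
exists C; split=> [|m]; first by rewrite /C; lra.
have small (k : nat) : (k <= M)%N -> normc (binom_coef a x k) <= C * q ^+ k.
  move=> kM; rewrite -ler_pdivrMr ?exprn_gt0// /C.
  have kM1 : (k < M.+1)%N by [].
  rewrite (bigD1 (Ordinal kM1))//= addrCA lerDl addr_ge0//.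
  by apply: sumr_ge0 => i _; rewrite divr_ge0 ?normc_ge0// exprn_ge0// ltW.
case: (leqP m M) => [/small//|Mm].
rewrite -(subnKC (ltnW Mm)); elim: (m - M)%N => [|k IH].
  by rewrite addn0; exact: small.
rewrite addnS (le_trans (step _ (leq_addr _ _)))// exprS mulrCA ler_pM2l//.
Qed.

Lemma binom_coef_cvg0 a x e : normc x < 1 -> 0 < e ->
  \forall n \near \oo, normc (binom_coef a x n) < e.
Proof.
move=> x1 e0; have x0 := normc_ge0 x.
pose q := (normc x + 1) / 2.
have xq : normc x < q by rewrite /q; lra.
have [C [C0 CP]] := binom_coef_geometric a xq.
have q1 : `|q| < 1 by rewrite ger0_norm /q; lra.
have := cvg_expr q1.
move=> /cvgrPdist_lt /(_ (e / C) (divr_gt0 e0 C0)).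
apply: filterS => n; rewrite sub0r normrN normrX ltr_pdivlMr// => h.
apply: le_lt_trans h; rewrite mulrC (le_trans (CP n))//.
by rewrite ler_wpM2l ?(ltW C0)// ger0_norm// /q; lra.
Qed.

Definition binom_partial a x n t : R[i] := \sum_(m < n.+1) binom_coef a x m * t%:C ^+ m.

(** [(1 - x t)^(-a)] satisfies [y' (1 - x t) = a x y]; for the partial sums all
    terms of the difference cancel except one of degree [n]. *)
Lemma binom_partial_ode a x n t :
  (\sum_(m < n.+1) binom_coef a x m * (m%:R * t%:C ^+ m.-1)) * (1 - x * t%:C) -
    a * x * binom_partial a x n t = - (a * x * binom_coef (a + 1) x n * t%:C ^+ n).
Proof.
rewrite /binom_partial; elim: n => [|n IH].
  by rewrite !big_ord1/= !binom_coef0 expr0; ring.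
rewrite big_ord_recr/= [in X in _ - a * x * X]big_ord_recr/=.
move: IH; set S1 := \sum_(m < n.+1) _ * (_ * _); set S2 := \sum_(m < n.+1) _ => IH.
rewrite (_ : _ - _ = (S1 * (1 - x * t%:C) - a * x * S2) +
  (binom_coef a x n.+1 * (n.+1%:R * t%:C ^+ n) * (1 - x * t%:C) -
   a * x * (binom_coef a x n.+1 * t%:C ^+ n.+1))); last by ring.
rewrite IH.
have e1 := binom_coefS1 a x n; have e2 := binom_coefS1 a x n.+1; have e3 := binom_coefS a x n.+1.
rewrite -e1 -e2 e3 !exprS; ring.
Qed.

Lemma is_cderive_binom_partial a x n t :
  is_cderive (binom_partial a x n) t
    (\sum_(m < n.+1) binom_coef a x m * (m%:R * t%:C ^+ m.-1)).
Proof.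
apply: (@is_cderive_sum _ (fun m s => binom_coef a x m * s%:C ^+ m)
  (fun m => binom_coef a x m * (m%:R * t%:C ^+ m.-1))) => m _.
apply: is_cderiveZ; have := is_cderiveX m (is_cderive_real (is_derive_id t 1)).
by move=> /is_cderiveE; apply => //; rewrite mulr1.
Qed.

Lemma log_onesub0 x : log_onesub x 0 = 0.
Proof. by rewrite /log_onesub !mulr0 subr0 oppr0 mul0r atan0 expr1n expr0n addr0 ln1 mulr0. Qed.

Lemma log_onesub_bound x : normc x < 1 -> exists2 B : R, 0 < B &
  forall t, 0 <= t <= 1 -> normc (log_onesub x t) <= B.
Proof.
move=> x1; have x0 := normc_ge0 x.
pose d := 1 - normc x; have d0 : 0 < d by rewrite subr_gt0.
exists (2^-1 * (d ^-2 + 7) + 2) => [|t t01].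
  by have : 0 < d ^- 2 by [rewrite invr_gt0 exprn_gt0]; lra.
rewrite (le_trans (ler_normc_ReIm _))// lerD//=; last first.
  have h1 := atan_ltpi2 (- (Im x * t) / (1 - Re x * t)).
  have h2 := atan_gtNpi2 (- (Im x * t) / (1 - Re x * t)).
  have /andP[_ h3] := (@pihalf_02_cos_pihalf R).1.
  by rewrite ler_norml; lra.
have f0 := Re_onesub_gt0 x1 t01; have /andP[t0 t1] := t01.
have xt : normc x * t <= normc x by rewrite ler_piMr.
have rx := ler_norm_Re x; have ix := ler_norm_Im x.
have df : d <= 1 - Re x * t.
  rewrite /d lerB// (le_trans _ xt)// ler_wpM2r// (le_trans (ler_norm _))//.
have f2 : 1 - Re x * t <= 2.
  have : - (Re x * t) <= normc x * t.
    by rewrite -mulNr ler_wpM2r// (le_trans (ler_norm _))// normrN.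
  lra.
have g2 : (Im x * t) ^+ 2 <= 1.
  rewrite -real_normK ?num_real// normrM (ger0_norm t0) exprn_ile1 ?mulr_ge0//.
  by rewrite mulr_ile1// (le_trans ix)// ltW.
set Q := _ + _.
have dQ : d ^+ 2 <= Q.
  rewrite /Q; apply: ler_wpDr; first exact: sqr_ge0.
  by rewrite lerXn2r ?nnegrE// ltW.
have Q5 : Q <= 5.
  rewrite /Q; have : (1 - Re x * t) ^+ 2 <= 2 ^+ 2 by rewrite lerXn2r ?nnegrE// ltW.
  lra.
have d20 : 0 < d ^+ 2 by rewrite exprn_gt0.
have Q0 : 0 < Q by apply: lt_le_trans dQ.
rewrite normrM gtr0_norm// ler_pM2l// ler_norml.
have l1 : ln (1 + (Q - 1)) <= Q - 1 by apply: le_ln1Dx; lra.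
have l2 : ln (1 + (Q^-1 - 1)) <= Q^-1 - 1.
  by apply: le_ln1Dx; rewrite ltrBrDl subrr invr_gt0.
move: l1 l2; rewrite !subrKC lnV ?posrE// => l1 l2.
have Qd : Q^-1 <= d ^- 2 by rewrite lef_pV2 ?posrE.
have Qi0 : 0 < Q^-1 by rewrite invr_gt0.
lra.
Qed.

(** Multiplied by [E = (1 - x t)^a], the partial sum has the derivative
    [h'], which by [binom_partial_ode] and [binom_coef_cvg0] (for the exponent
    [a + 1]) tends to zero uniformly on [[0, 1]]; hence this product tends to
    its value 1 at the origin. *)
Lemma binomial_series a x t e : normc x < 1 -> 0 <= t <= 1 -> 0 < e ->
  \forall n \near \oo,
    normc (cpow (1 - x * t%:C) (- a) - \sum_(m < n) binom_coef a x m * t%:C ^+ m) < e.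
Proof.
move=> x1 t01 e0; have /andP[t0 t1] := t01.
have [B B0 BP] := log_onesub_bound x1.
pose d := 1 - normc x; have d0 : 0 < d by rewrite subr_gt0.
pose E s := cexp (a * log_onesub x s).
pose K := expR (normc a * B).
have K0 : 0 < K by exact: expR_gt0.
have normcE c s : 0 <= s <= 1 -> normc c <= normc a -> normc (cexp (c * log_onesub x s)) <= K.
  move=> s01 ca; rewrite normc_cexp ler_expR (le_trans (ler_norm _))//.
  rewrite (le_trans (ler_norm_Re _))// Normc.normcM ler_pM ?normc_ge0//.
  exact: BP.
have normcz s : 0 <= s <= 1 -> d <= normc (1 - x * s%:C).
  move=> /andP[s0 s1]; rewrite (le_trans _ (ler_norm_Re _))// (le_trans _ (ler_norm _))//.
  rewrite onesubE/= lerD2l lerN2.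
  apply: (@le_trans _ _ (normc x * s)).
    by rewrite ler_wpM2r// (le_trans (ler_norm _)) ?ler_norm_Re.
  by rewrite ler_piMr ?normc_ge0.
pose h n s := binom_partial a x n s * E s.
pose h' n s := - (a * x * binom_coef (a + 1) x n * s%:C ^+ n) * ((1 - x * s%:C)^-1 * E s).
have dh n s : 0 <= s <= 1 -> is_cderive (h n) s (h' n s).
  move=> s01.
  have z0 : 1 - x * s%:C != 0.
    by rewrite -normc_eq0 gt_eqF// (lt_le_trans d0)// normcz.
  have := is_cderiveM (is_cderive_binom_partial a x n s)
    (is_cderive_cexp (is_cderiveZ a (is_cderive_log_onesub x1 s01))).
  move=> /is_cderiveE; apply => //.
  by rewrite /h' -binom_partial_ode /E; field; rewrite z0.
pose D := normc a * normc x * (d^-1 * K) + 1.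
have D0 : 0 < D.
  by rewrite ltr_wpDl// !mulr_ge0 ?normc_ge0// ?invr_ge0 ltW.
have bh n s : 0 <= s <= 1 -> normc (h' n s) <= D * normc (binom_coef (a + 1) x n).
  move=> s01; have /andP[s0 s1] := s01.
  have nE (b w v : R[i]) : normc (- (a * x * b * s%:C ^+ n) * (w^-1 * v)) =
      normc a * normc x * normc b * s ^+ n * ((normc w)^-1 * normc v).
    by rewrite !Normc.normcM normcN !Normc.normcM Normc.normcV normcX normc_ge0_real.
  rewrite /h' nE.
  have b0 := normc_ge0 (binom_coef (a + 1) x n).
  have a0 := normc_ge0 a; have x0 := normc_ge0 x.
  have zE : (normc (1 - x * s%:C))^-1 * normc (E s) <= d^-1 * K.
    apply: ler_pM; rewrite ?invr_ge0 ?normc_ge0//; last exact: normcE.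
    by rewrite lef_pV2 ?posrE ?normcz// (lt_le_trans d0)// normcz.
  have zE0 : 0 <= (normc (1 - x * s%:C))^-1 * normc (E s).
    by rewrite mulr_ge0 ?invr_ge0 ?normc_ge0.
  have sn : s ^+ n <= 1 by rewrite exprn_ile1.
  have sn0 : 0 <= s ^+ n by rewrite exprn_ge0.
  apply: (@le_trans _ _ (normc a * normc x * normc (binom_coef (a + 1) x n) * 1 * (d^-1 * K))).
    have abx0 : 0 <= normc a * normc x * normc (binom_coef (a + 1) x n).
      by apply: mulr_ge0 => //; apply: mulr_ge0.
    by apply: ler_pM => //; [exact: mulr_ge0|exact: ler_wpM2l].
  rewrite mulr1 /D mulrDl mul1r; apply: ler_wpDr => //.
  by rewrite le_eqVlt; apply/orP; left; apply/eqP; ring.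
have h0 n : h n 0 = 1.
  rewrite /h /E log_onesub0 mulr0 cexp0 mulr1 /binom_partial big_ord_recl/= binom_coef0 expr0 mulr1.
  by rewrite big1 ?addr0// => i _; rewrite expr0n/= mulr0.
have hh n : normc (h n t - 1) <= 2 * (D * normc (binom_coef (a + 1) x n)).
  rewrite (_ : h n t - 1 = h n t - h n 0); last by rewrite h0.
  rewrite (le_trans (ler_normc_ReIm _))// mulr_natl mulr2n !(cReD, cReN, cImD, cImN).
  have st s : 0 <= s <= t -> 0 <= s <= 1.
    by move=> /andP[-> /le_trans]; apply.
  have DM : 0 <= D * normc (binom_coef (a + 1) x n).
    by rewrite mulr_ge0 ?normc_ge0// ltW.
  have Dt : D * normc (binom_coef (a + 1) x n) * t <=
      D * normc (binom_coef (a + 1) x n) by rewrite ler_piMr.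
  apply: lerD; apply: (le_trans _ Dt).
  - apply: (@ler_norm_MVT _ (fun s => Re (h n s)) (fun s => Re (h' n s))) => // s /st s01.
      by have [] := dh n s s01.
    by rewrite (le_trans (ler_norm_Re _))// bh.
  - apply: (@ler_norm_MVT _ (fun s => Im (h n s)) (fun s => Im (h' n s))) => // s /st s01.
      by have [] := dh n s s01.
    by rewrite (le_trans (ler_norm_Im _))// bh.
have eD : 0 < e / (2 * D * K) by rewrite divr_gt0// !mulr_gt0.
have [N _ NP] := binom_coef_cvg0 (a + 1) x1 eD.
exists N.+1 => // -[//|n] /= Nn.
have := NP n Nn; rewrite ltr_pdivlMr ?mulr_gt0// => hn.
have E0 : E t != 0 by exact: cexp_neq0.
rewrite cpow_onesub// mulNr cexpN -/(E t) -[X in _ - X]/(binom_partial a x n t).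
rewrite (_ : _ - _ = - ((E t)^-1 * (h n t - 1))); last by rewrite /h; field.
rewrite normcN Normc.normcM.
have -> : (E t)^-1 = cexp (- a * log_onesub x t) by rewrite /E mulNr cexpN.
apply: (@le_lt_trans _ _ (K * (2 * (D * normc (binom_coef (a + 1) x n))))).
  by apply: ler_pM; rewrite ?normc_ge0// normcE ?normcN.
apply: le_lt_trans hn; rewrite le_eqVlt; apply/orP; left; apply/eqP; ring.
Qed.

End BinomialSeries.

(** * Series dominated by a geometric series *)
Section GeometricSeries.
Context {R : realType}.
Implicit Types (u a b : nat -> R[i]) (s : R[i]) (C q e : R).

(** The sum of [C * q ^ k] over [k >= n]. *)
Definition gtail C q n : R := C * q ^+ n / (1 - q).

Lemma gtail_ge0 C q n : 0 <= C -> 0 <= q < 1 -> 0 <= gtail C q n.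
Proof.
by move=> C0 /andP[q0 q1]; rewrite divr_ge0 ?mulr_ge0 ?exprn_ge0// subr_ge0 ltW.
Qed.

Lemma gtail_sum C q m n : q < 1 ->
  \sum_(k < n) C * q ^+ (m + k) = gtail C q m - gtail C q (m + n).
Proof.
move=> q1; have q10 : 1 - q != 0 by rewrite subr_eq0 gt_eqF.
elim: n => [|n IH]; first by rewrite big_ord0 addn0 subrr.
by rewrite big_ord_recr/= IH addnS /gtail exprS; field.
Qed.

Lemma gtail_cvg0 C q : 0 <= q < 1 -> gtail C q n @[n --> \oo] --> (0 : R).
Proof.
move=> /andP[q0 q1].
have q1' : `|q| < 1 by rewrite ger0_norm.
rewrite (_ : gtail C q = (fun n => (C / (1 - q)) * q ^+ n)).
  rewrite -[X in _ --> X](mulr0 (C / (1 - q))); apply: cvgMr; exact: cvg_expr.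
by apply/funext => n; rewrite /gtail; ring.
Qed.

Lemma partial_sum_dist u C q m n : 0 <= C -> 0 <= q < 1 ->
  (forall k, normc (u k) <= C * q ^+ k) -> (m <= n)%N ->
  normc (\sum_(k < n) u k - \sum_(k < m) u k) <= gtail C q m.
Proof.
move=> C0 q01 uC mn; have /andP[q0 q1] := q01.
rewrite -(subnKC mn) big_split_ord/= addrAC subrr add0r.
rewrite (le_trans (ler_normc_sum _ _ _))//.
apply: (@le_trans _ _ (\sum_(k < n - m) C * q ^+ (m + k))).
  by apply: ler_sum => k _; exact: uC.
by rewrite gtail_sum// gerBl gtail_ge0.
Qed.

Lemma partial_sum_tail u s C q m : 0 <= C -> 0 <= q < 1 ->
  (forall k, normc (u k) <= C * q ^+ k) ->
  (forall e, 0 < e -> \forall n \near \oo, normc (s - \sum_(k < n) u k) < e) ->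
  normc (s - \sum_(k < m) u k) <= gtail C q m.
Proof.
move=> C0 q01 uC us; apply/ler_addgt0Pr => e e0.
have [N _ NP] := us e e0.
have := NP (maxn N m) (leq_maxl _ _).
have := partial_sum_dist C0 q01 uC (leq_maxr N m).
set X := \sum_(k < m) _; set Y := \sum_(k < maxn _ _) _ => h1 h2.
rewrite (_ : s - X = (Y - X) + (s - Y)); last by ring.
by rewrite (le_trans (ler_normcD _ _))// lerD// ltW.
Qed.

Lemma geometric_summable u C q : 0 <= C -> 0 <= q < 1 ->
  (forall k, normc (u k) <= C * q ^+ k) -> exists s,
  forall e, 0 < e -> \forall n \near \oo, normc (s - \sum_(k < n) u k) < e.
Proof.
move=> C0 q01 uC; have /andP[q0 q1] := q01.
have cv (v : nat -> R) : (forall k, `|v k| <= C * q ^+ k) -> cvgn (series v).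
  move=> vC; apply: normed_cvg.
  apply: (@series_le_cvg _ _ (geometric C q)) => //.
  - by move=> n /=.
  - by move=> n; rewrite /geometric/= mulr_ge0 ?exprn_ge0.
  - by apply: is_cvg_geometric_series; rewrite ger0_norm.
have cR : cvgn (series (fun k => Re (u k))).
  by apply: cv => k; rewrite (le_trans (ler_norm_Re _)).
have cI : cvgn (series (fun k => Im (u k))).
  by apply: cv => k; rewrite (le_trans (ler_norm_Im _)).
exists (limn (series (fun k => Re (u k))) +i* limn (series (fun k => Im (u k)))).
move=> e e0; have e2 : 0 < e / 2 by rewrite divr_gt0.
move/cvgrPdist_lt : cR => /(_ _ e2) cR; move/cvgrPdist_lt : cI => /(_ _ e2) cI.
near=> n.
rewrite (le_lt_trans (ler_normc_ReIm _))// [ltRHS]splitr.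
have sumRe : Re (\sum_(k < n) u k) = series (fun k => Re (u k)) n.
  by rewrite /series/= big_mkord; elim/big_ind2 : _ => // x y z w <- <-; rewrite cReD.
have sumIm : Im (\sum_(k < n) u k) = series (fun k => Im (u k)) n.
  by rewrite /series/= big_mkord; elim/big_ind2 : _ => // x y z w <- <-; rewrite cImD.
rewrite !(cReD, cReN, cImD, cImN) sumRe sumIm; apply: ltrD.
- by near: n.
- by near: n.
Unshelve. all: by end_near. Qed.

Lemma cseriesP u s :
  (forall e, 0 < e -> \forall n \near \oo, normc (s - \sum_(k < n) u k) < e) ->
  ccvg_series u /\ cseries u = s.
Proof.
move=> us.
have H : series (u : nat -> R[i]^o) @ \oo --> (s : R[i]^o).
  apply/ccvgP => e /us; apply: filterS => n.
  by rewrite /series/= big_mkord.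
split; first by apply/cvg_ex; exists s.
by rewrite /cseries; apply: (@cvg_lim _ (@norm_hausdorff _ _) _ _ _ _ _ H).
Qed.

Lemma sum_subseq (T : eqType) (V : nmodType) (U W : seq T) (F : T -> V) :
  uniq U -> uniq W -> {subset W <= U} ->
  \sum_(x <- W) F x = \sum_(x <- U | x \in W) F x.
Proof.
move=> uU uW WU; rewrite -[RHS]big_filter; apply: perm_big.
apply: uniq_perm => //; first exact: filter_uniq.
move=> x; rewrite mem_filter; case: (boolP (x \in W)) => //= /WU -> //.
Qed.

Definition square n : seq (nat * nat) := [seq (i, j) | i <- iota 0 n, j <- iota 0 n].

Lemma square_uniq n : uniq (square n).
Proof. by apply: allpairs_uniq; rewrite ?iota_uniq// => -[? ?] [? ?]. Qed.

Lemma mem_square n x : (x \in square n) = (x.1 < n)%N && (x.2 < n)%N.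
Proof.
case: x => i j; apply/allpairsP/andP => /= [[[k l]] /= []|[iN jN]].
  by rewrite !mem_iota /= !add0n => ? ? [-> ->].
by exists (i, j); rewrite !mem_iota /= !add0n.
Qed.

Lemma sum_square (V : pzSemiRingType) (f g : nat -> V) n :
  \sum_(x <- square n) f x.1 * g x.2 = (\sum_(i < n) f i) * (\sum_(j < n) g j).
Proof.
rewrite /square big_allpairs/= -(big_mkord predT f) -(big_mkord predT g).
rewrite /index_iota subn0 big_distrl/=.
by apply: eq_bigr => i _; rewrite big_distrr.
Qed.

(** Enclose [B] in a large square; the sum over the difference of two squares
    is explicit. *)
Lemma sum_outside_square C1 C2 q1 q2 n (B : seq (nat * nat)) :
  0 <= C1 -> 0 <= C2 -> 0 <= q1 < 1 -> 0 <= q2 < 1 -> uniq B ->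
  \sum_(x <- B | x \notin square n) C1 * q1 ^+ x.1 * (C2 * q2 ^+ x.2) <=
  gtail C1 q1 0 * gtail C2 q2 n + gtail C1 q1 n * gtail C2 q2 0.
Proof.
move=> C10 C20 q1b q2b uB; have /andP[q10 q11] := q1b; have /andP[q20 q21] := q2b.
pose g x : R := C1 * q1 ^+ x.1 * (C2 * q2 ^+ x.2).
have g0 (x : nat * nat) : 0 <= g x by rewrite !mulr_ge0// exprn_ge0.
have [M nM BM] : exists2 M, (n <= M)%N & {subset B <= square M}.
  exists (maxn n (\max_(x <- B) maxn x.1 x.2).+1); first exact: leq_maxl.
  move=> x xB; rewrite mem_square -gtn_max leq_max; apply/orP; right.
  by rewrite ltnS; exact: (leq_bigmax_seq (F := fun x => maxn x.1 x.2)).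
have sqE k : \sum_(x <- square k) g x =
    (gtail C1 q1 0 - gtail C1 q1 k) * (gtail C2 q2 0 - gtail C2 q2 k).
  rewrite (sum_square (fun i => C1 * q1 ^+ i) (fun j => C2 * q2 ^+ j)).
  have := @gtail_sum C1 q1 0 k q11; have := @gtail_sum C2 q2 0 k q21.
  by rewrite !add0n => <- <-.
have sub : {subset square n <= square M}.
  move=> x; rewrite !mem_square => /andP[h1 h2].
  by rewrite !(leq_trans _ nM).
apply: (@le_trans _ _ (\sum_(x <- square M | x \notin square n) g x)).
  rewrite -big_filter [leRHS]big_mkcond/=.
  rewrite [leLHS](@sum_subseq _ _ (square M)) ?filter_uniq ?square_uniq//; last first.
    by move=> x; rewrite mem_filter => /andP[_ /BM].
  rewrite big_mkcond/=; apply: ler_sum => x _.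
  by rewrite mem_filter; case: (x \notin square n) => //=; case: (x \in B) => //; exact: g0.
have -> : \sum_(x <- square M | x \notin square n) g x =
    \sum_(x <- square M) g x - \sum_(x <- square n) g x.
  rewrite [X in _ = X - _](bigID (fun x => x \in square n))/=.
  by rewrite -sum_subseq ?square_uniq// addrAC subrr add0r.
rewrite !sqE.
have := gtail_ge0 0 C10 q1b; have := gtail_ge0 0 C20 q2b.
have := gtail_ge0 n C10 q1b; have := gtail_ge0 n C20 q2b.
have := gtail_ge0 M C10 q1b; have := gtail_ge0 M C20 q2b.
have h1 : gtail C1 q1 M <= gtail C1 q1 0.
  rewrite /gtail ler_pM2r ?invr_gt0 ?subr_gt0// ler_wpM2l// expr0 exprn_ile1//.
  exact: ltW.
have h2 : gtail C2 q2 M <= gtail C2 q2 0.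
  rewrite /gtail ler_pM2r ?invr_gt0 ?subr_gt0// ler_wpM2l// expr0 exprn_ile1//.
  exact: ltW.
move: h1 h2; set A := gtail C1 q1 0; set A' := gtail C1 q1 M; set A'' := gtail C1 q1 n.
set D := gtail C2 q2 0; set D' := gtail C2 q2 M; set D'' := gtail C2 q2 n.
move=> h1 h2 h3 h4 h5 h6 h7 h8.
have : (A - A') * (D - D') <= A * D.
  by apply: ler_pM; rewrite ?subr_ge0// gerBl.
have : 0 <= A'' * D'' by rewrite mulr_ge0.
lra.
Qed.

(** Split the sum over [B] into the square, whose sum is a product of partial
    sums, and the rest, bounded by [sum_outside_square]. *)
Lemma product_sum_dist a b s1 s2 C1 C2 q1 q2 n (B : seq (nat * nat)) :
  0 <= C1 -> 0 <= C2 -> 0 <= q1 < 1 -> 0 <= q2 < 1 ->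
  (forall k, normc (a k) <= C1 * q1 ^+ k) -> (forall k, normc (b k) <= C2 * q2 ^+ k) ->
  (forall m, normc (s1 - \sum_(k < m) a k) <= gtail C1 q1 m) ->
  (forall m, normc (s2 - \sum_(k < m) b k) <= gtail C2 q2 m) ->
  uniq B -> {subset square n <= B} ->
  normc (s1 * s2 - \sum_(x <- B) a x.1 * b x.2) <=
  2 * (gtail C1 q1 0 * gtail C2 q2 n + gtail C1 q1 n * gtail C2 q2 0).
Proof.
move=> C10 C20 q1b q2b aC bC as1 bs2 uB sB.
rewrite (bigID (fun x => x \in square n))/= -sum_subseq ?square_uniq// sum_square.
set a' := \sum_(i < n) a i; set b' := \sum_(i < n) b i; set S := \sum_(x <- B | _) _.
rewrite (_ : s1 * s2 - (a' * b' + S) = (s1 - a') * s2 + a' * (s2 - b') - S); last by ring.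
have nS : normc S <= gtail C1 q1 0 * gtail C2 q2 n + gtail C1 q1 n * gtail C2 q2 0.
  rewrite (le_trans (ler_normc_sum _ _ _))//.
  apply: le_trans (@sum_outside_square C1 C2 q1 q2 n B C10 C20 q1b q2b uB).
  apply: ler_sum => x _; rewrite Normc.normcM.
  by apply: ler_pM; rewrite ?normc_ge0.
have na' : normc a' <= gtail C1 q1 0.
  have := partial_sum_dist C10 q1b aC (leq0n n).
  by rewrite big_ord0 subr0.
have ns2 : normc s2 <= gtail C2 q2 0.
  by have := bs2 0%N; rewrite big_ord0 subr0.
rewrite (le_trans (ler_normcB _ _))// mulr_natl mulr2n lerD//.
rewrite (le_trans (ler_normcD _ _))// !Normc.normcM addrC.
apply: lerD; apply: ler_pM; rewrite ?normc_ge0//; [exact: bs2|exact: as1].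
Qed.

End GeometricSeries.

(** * Coefficients of the Mittag-Leffler and Wright series *)
Section MittagLeffler.
Context {R : realType}.
Implicit Types (p z : R[i]) (lambda : R).

Definition mlcoef lambda p (k : nat) : R[i] :=
  p ^+ k / Gamma (lambda * k%:R + 1)%:C.

(** The factor 4 compensates the values of [t (1-t)], at most 1/4.  For
    [lambda > 0] apply [Gamma_real_lb] with [M = e^L], where [L] is such that
    [M^(lambda k)] absorbs [(`|p| / 2)^k]. *)
Lemma mlcoef_geometric lambda p : 0 <= lambda -> (lambda = 0 -> normc p < 4) ->
  exists C : R, exists q : R, [/\ 0 <= C, 0 <= q < 1 &
    forall k, normc (mlcoef lambda p k) <= C * (4 * q) ^+ k].
Proof.
move=> l0; have p0 := normc_ge0 p; case: (eqVneq lambda 0) => [->|ln0] hp.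
  exists 1, (normc p / 4); split => //.
    by have := hp erefl; rewrite divr_ge0//= ltr_pdivrMr// mul1r.
  move=> k; rewrite /mlcoef mul0r add0r Gamma1 divr1 normcX mul1r.
  by rewrite mulrCA divff ?mulr1.
have lp : 0 < lambda by rewrite lt_def ln0.
pose L := normc p / (2 * lambda).
exists (expR (expR L + 1)), 2^-1; split; rewrite ?expR_ge0//; first lra.
move=> k; have := @Gamma_real_lb R (lambda * k%:R) (expR L).
rewrite expRK => /(_ _ (expR_gt0 _)); rewrite mulr_ge0// => /(_ erefl) G.
have G0 : 0 < normc (Gamma (lambda * k%:R + 1)%:C).
  by apply: lt_le_trans G; exact: expR_gt0.
rewrite /mlcoef Normc.normcM Normc.normcV normcX ler_pdivrMr//.
set y := normc p / 2.
have LE : lambda * k%:R * L = y * k%:R by rewrite /L /y; field.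
have hy : y <= expR y by rewrite (le_trans _ (expR_ge1Dx _))// lerDr.
have y0 : 0 <= y by rewrite divr_ge0.
have pk : normc p ^+ k <= 2 ^+ k * expR (y * k%:R).
  rewrite expRM_natr -exprMn lerXn2r ?nnegrE ?mulr_ge0 ?expR_ge0//.
  by move: hy; rewrite /y; lra.
rewrite LE in G.
have -> : 4 * 2^-1 = 2 :> R by field.
apply: (le_trans pk).
rewrite (_ : expR (expR L + 1) * 2 ^+ k * _ = 2 ^+ k * (expR (expR L + 1) *
  normc (Gamma (lambda * k%:R + 1)%:C))); last by ring.
rewrite ler_pM2l ?exprn_gt0//.
have -> : expR (y * k%:R) = expR (expR L + 1) * expR (y * k%:R - (expR L + 1)).
  by rewrite -expRD; congr expR; ring.
by rewrite ler_pM2l ?expR_gt0.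
Qed.

End MittagLeffler.

Section WrightCoef.
Context {R : realType}.

Lemma wright_coef_nil k : wright_coef (nil : seq (R[i] * R)) k = 1.
Proof. by rewrite /wright_coef big_nil. Qed.

Lemma wright_coef_cons (a : R[i]) (A : R) (s : seq (R[i] * R)) k :
  wright_coef ((a, A) :: s) k =
  Gamma (a + (A * k%:R)%:C) / Gamma a * wright_coef s k.
Proof. by rewrite /wright_coef big_cons. Qed.

End WrightCoef.

(** * Termwise integration *)
Section TermwiseIntegration.
Context {R : realType}.
Variables (alpha beta alpha1 alpha2 x1 x2 p : R[i]) (lambda : R).
Hypotheses (halpha : 0 < Re alpha) (hbeta : 0 < Re beta) (hlambda : 0 <= lambda).
Hypotheses (hx1 : normc x1 < 1) (hx2 : normc x2 < 1).
Hypothesis (hp : lambda = 0 -> normc p < 4).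

Let D : set R := `]0, 1[%classic.
Let mD : measurable D. Proof. exact: measurable_itv. Qed.

Let D01 t : D t -> 0 < t < 1. Proof. by rewrite /D /= in_itv. Qed.

Let E t := mittag_leffler lambda (p * t%:C * (1 - t%:C)).
Let w := betaf alpha beta.
Let h t := normc (w t).
Let ek k := mlcoef lambda p k.

Lemma weight_integrable : mu.-integrable D (EFin \o h).
Proof.
have := integrable_beta_weight halpha hbeta.
by apply: eq_integrable => // t _ /=; rewrite /h /w normc_betaf.
Qed.

Let H := (\int[mu]_(t in D) h t)%R.

Let H0 : 0 <= H. Proof. by apply: Rintegral_ge0 => t _; exact: normc_ge0. Qed.

Lemma realX_measurable (n : nat) : cmeasurable D (fun t => t%:C ^+ n : R[i]).
Proof. by apply: cmeasurableX; apply: cmeasurable_real. Qed.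

Let binom_term (a x : R[i]) (t : R) m := binom_coef a x m * t%:C ^+ m.

Lemma binom_term_bound a x K r t : D t ->
  (forall m, normc (binom_coef a x m) <= K * r ^+ m) ->
  forall m, normc (binom_term a x t m) <= K * r ^+ m.
Proof.
move=> /D01/andP[t0 t1] bK m; rewrite /binom_term Normc.normcM normcX.
rewrite (normc_ge0_real (ltW t0)) (le_trans _ (bK m))// ler_piMr ?normc_ge0//.
by rewrite exprn_ile1// ltW.
Qed.

Let F (a x : R[i]) (t : R) := cpow (1 - x * t%:C) (- a).

Lemma binom_tail a x K r t n : D t -> normc x < 1 -> 0 <= K -> 0 <= r < 1 ->
  (forall m, normc (binom_coef a x m) <= K * r ^+ m) ->
  normc (F a x t - \sum_(m < n) binom_term a x t m) <= gtail K r n.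
Proof.
move=> Dt xl K0 r01 bK; apply: partial_sum_tail => //.
  exact: binom_term_bound.
move=> e e0; apply: binomial_series => //.
by have /andP[t0 t1] := D01 Dt; rewrite !ltW.
Qed.

Lemma binom_measurable a x : normc x < 1 -> cmeasurable D (F a x).
Proof.
move=> xl; apply: (cmeasurable_lim (f_ := fun n t => \sum_(m < n) binom_term a x t m) mD).
- move=> n; apply: cmeasurable_sum => k; apply: cmeasurableM; first exact: cmeasurable_cst.
  exact: realX_measurable.
- move=> t Dt e e0; apply: binomial_series => //.
  by have /andP[t0 t1] := D01 Dt; rewrite !ltW.
Qed.

Lemma weighted_integrable (g : R -> R[i]) (M : R) : cmeasurable D g ->
  (forall t, D t -> normc (g t) <= M) -> cintegrable D (fun t => w t * g t).
Proof.
move=> mg gM; apply: (@cintegrable_le _ _ _ (fun t => M * h t)) => //.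
- by apply: cmeasurableM => //; exact: betaf_measurable.
- rewrite (_ : _ \o _ = (fun t => M%:E * (EFin \o h) t)%E)//.
  by apply: (@integrableZl _ _ _ (@lebesgue_measure R)) => //; exact: weight_integrable.
- by move=> t Dt; rewrite Normc.normcM mulrC ler_wpM2r ?normc_ge0 ?gM.
Qed.

(** This is the only estimate used to pass to the limit under the integral. *)
Lemma weighted_bound (g : R -> R[i]) (M : R) : cmeasurable D g ->
  (forall t, D t -> normc (g t) <= M) ->
  normc (cintegral D (fun t => w t * g t)) <= 2 * (M * H).
Proof.
move=> mg gM; have ig := weighted_integrable mg gM.
have iM : mu.-integrable D (EFin \o (fun t => M * h t)).
  rewrite (_ : _ \o _ = (fun t => M%:E * (EFin \o h) t)%E)//.
  by apply: (@integrableZl _ _ _ (@lebesgue_measure R)) => //; exact: weight_integrable.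
apply: (le_trans (ler_normc_cintegral mD ig iM _)).
  by move=> t Dt; rewrite Normc.normcM mulrC ler_wpM2r ?normc_ge0 ?gM.
by rewrite (@RintegralZl _ _ _ (@lebesgue_measure R))//; exact: weight_integrable.
Qed.

Let D_pow t n : D t -> normc (t%:C ^+ n) <= 1.
Proof.
move=> /D01/andP[t0 t1].
by rewrite normcX normc_ge0_real ?exprn_ile1// ltW.
Qed.

Section WithBounds.
Variables (C q : R).
Hypotheses (C0 : 0 <= C) (q01 : 0 <= q < 1)
  (ekC : forall k, normc (ek k) <= C * (4 * q) ^+ k).

Let eterm t k := ek k * (t * (1 - t))%:C ^+ k.

Let eterm_bound t k : D t -> normc (eterm t k) <= C * q ^+ k.
Proof.
move=> /D01/andP[t0 t1]; have /andP[q0 q1] := q01.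
have tt0 : 0 <= t * (1 - t) by rewrite mulr_ge0 ?subr_ge0// ltW.
rewrite /eterm Normc.normcM normcX normc_ge0_real//.
have t4 : t * (1 - t) <= 4^-1 by have := sqr_ge0 (2 * t - 1); nra.
apply: (@le_trans _ _ (C * (4 * q) ^+ k * 4^-1 ^+ k)).
  apply: ler_pM; rewrite ?normc_ge0 ?exprn_ge0//.
  by rewrite lerXn2r ?nnegrE.
rewrite -mulrA -exprMn (_ : 4 * q * 4^-1 = q)//; by field.
Qed.

Lemma ml_tail t n : D t ->
  normc (E t - \sum_(k < n) eterm t k) <= gtail C q n.
Proof.
move=> Dt; apply: partial_sum_tail => // [k|]; first exact: eterm_bound.
have [s sP] := geometric_summable C0 q01 (fun k => @eterm_bound t k Dt).
have [_] := cseriesP sP.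
suff -> : E t = cseries (eterm t) by move=> ->.
congr cseries; apply/funext => k; rewrite /eterm /ek /mlcoef.
rewrite rmorphM rmorphB/= !exprMn; ring.
Qed.

Lemma ml_measurable : cmeasurable D E.
Proof.
apply: (cmeasurable_lim (f_ := fun n t => \sum_(k < n) eterm t k) mD).
- move=> n; apply: cmeasurable_sum => k; rewrite /eterm.
  apply: cmeasurableM; first exact: cmeasurable_cst.
  apply: cmeasurableX; apply: cmeasurable_real.
  by apply: measurable_funM => //; apply: measurable_funB.
- move=> t Dt e e0.
  have /cvgrPdist_lt /(_ e e0) := @gtail_cvg0 R C q q01.
  apply: filterS => n; rewrite sub0r normrN ger0_norm ?gtail_ge0//.
  by apply: le_lt_trans; exact: ml_tail.
Qed.

Lemma ml_bound t : D t -> normc (E t) <= gtail C q 0.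
Proof. by move=> Dt; have := ml_tail 0 Dt; rewrite big_ord0 subr0. Qed.

Let I N := cintegral D (fun t => w t * (t%:C ^+ N * E t)).

Let tE_measurable N : cmeasurable D (fun t => t%:C ^+ N * E t).
Proof. by apply: cmeasurableM; [exact: realX_measurable|exact: ml_measurable]. Qed.

Let tE_bound N t : D t -> normc (t%:C ^+ N * E t) <= gtail C q 0.
Proof.
move=> Dt; rewrite Normc.normcM (le_trans _ (ml_bound Dt))//.
by rewrite ler_piMl ?normc_ge0// D_pow.
Qed.

(** Multiplying the Beta weight by powers of [t] and [1 - t] shifts its
    parameters. *)
Lemma beta_moments N k :
  cintegral D (fun t => w t * (t%:C ^+ N * eterm t k)) =
  ek k * Bint (alpha + (N + k)%:R) (beta + k%:R).
Proof.
rewrite /Bint -cintegralZ//; last by apply: betaf_integrable; exact: Re_gt0_addn.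
apply: eq_cintegral => t Dt; rewrite betafDn ?D01// -/w /eterm.
rewrite rmorphM/= exprMn exprD; ring.
Qed.

Lemma inner_series N e : 0 < e -> \forall n \near \oo,
  normc (I N - \sum_(k < n) ek k * Bint (alpha + (N + k)%:R) (beta + k%:R)) < e.
Proof.
move=> e0.
have eH : 0 < e / (2 * (H + 1)) by rewrite divr_gt0// mulr_gt0// ltr_wpDl.
have /cvgrPdist_lt /(_ _ eH) := @gtail_cvg0 R C q q01.
apply: filterS => n; rewrite sub0r normrN ger0_norm ?gtail_ge0//.
rewrite ltr_pdivlMr ?mulr_gt0 ?ltr_wpDl// => gn.
have mt k : cmeasurable D (fun t => t%:C ^+ N * eterm t k).
  apply: cmeasurableM; first exact: realX_measurable.
  apply: cmeasurableM; first exact: cmeasurable_cst.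
  apply: cmeasurableX; apply: cmeasurable_real.
  by apply: measurable_funM => //; apply: measurable_funB.
have it k : cintegrable D (fun t => w t * (t%:C ^+ N * eterm t k)).
  apply: (weighted_integrable (M := C * q ^+ k)) => // t Dt.
  rewrite Normc.normcM (le_trans _ (eterm_bound k Dt))//.
  by rewrite ler_piMl ?normc_ge0// D_pow.
under eq_bigr do rewrite -beta_moments.
rewrite -cintegral_sum// -cintegralB//; last 2 first.
- by apply: (weighted_integrable (M := gtail C q 0)) => // t; exact: tE_bound.
- exact: cintegrable_sum.
rewrite (@eq_cintegral _ _ _ (fun t => w t * (t%:C ^+ N * (E t - \sum_(k < n) eterm t k)))); last first.
  move=> t _; rewrite -big_distrr/= -mulrBr -big_distrr/=; ring.
apply: (@le_lt_trans _ _ (2 * (gtail C q n * H))).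
  apply: weighted_bound.
    apply: cmeasurableM; first exact: realX_measurable.
    have mE := ml_measurable.
    have ms : cmeasurable D (fun t => (-1) * \sum_(k < n) eterm t k).
      apply: cmeasurableM; first exact: cmeasurable_cst.
      apply: cmeasurable_sum => k.
      apply: cmeasurableM; first exact: cmeasurable_cst.
      apply: cmeasurableX; apply: cmeasurable_real.
      by apply: measurable_funM => //; apply: measurable_funB.
    have := cmeasurableD mE ms; apply: cmeasurable_eq => t _.
    by rewrite mulN1r.
  move=> t Dt; rewrite Normc.normcM (le_trans _ (ml_tail n Dt))//.
  by rewrite ler_piMl ?normc_ge0// D_pow.
apply: le_lt_trans gn; have := gtail_ge0 n C0 q01; move: H0; nra.
Qed.

Let upper N := [:: (alpha + N%:R, 1); (beta, 1); (1, 1)] : seq (R[i] * R).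
Let lower N := [:: (alpha + beta + N%:R, 2); (1, lambda)] : seq (R[i] * R).

Let hab : 0 < Re (alpha + beta). Proof. by rewrite cReD addr_gt0. Qed.

Let Kc N := pochhammer (alpha + beta) N / (pochhammer alpha N * Bint alpha beta).

(** The Gamma quotients of the Wright series are Pochhammer symbols, and [BintDn]
    turns their ratio into a Beta integral. *)
Lemma wright_termE N k :
  wright_term (upper N) (lower N) p k =
  Kc N * (ek k * Bint (alpha + (N + k)%:R) (beta + k%:R)).
Proof.
have aN := Re_gt0_addn N halpha; have abN := Re_gt0_addn N hab.
rewrite /wright_term /upper /lower !wright_coef_cons !wright_coef_nil.
have -> : (1 * k%:R : R)%:C = k%:R :> R[i] by rewrite natC mul1r.
have -> : (2 * k%:R : R)%:C = (k + k)%:R :> R[i].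
  by rewrite natC natrD mulr2n mulrDl mul1r.
have -> : 1 + (lambda * k%:R)%:C = (lambda * k%:R + 1)%:C :> R[i].
  by rewrite rmorphD addrC.
rewrite (GammaDn k aN) (GammaDn k hbeta) (GammaDn (k + k) abN) (GammaDn k (@Re1_gt0 R)).
rewrite Gamma1 pochhammer1.
have B := BintDn (N + k) k halpha hbeta.
rewrite -addnA (pochhammerD _ N (k + k)) (pochhammerD _ N k) in B.
have -> : Bint (alpha + (N + k)%:R) (beta + k%:R) =
    pochhammer alpha N * pochhammer (alpha + N%:R) k * pochhammer beta k * Bint alpha beta /
    (pochhammer (alpha + beta) N * pochhammer (alpha + beta + N%:R) (k + k)).
  by rewrite -B mulrC mulKf// mulf_neq0// pochhammer_neq0.
have G3 : Gamma (lambda * k%:R + 1)%:C != 0 :> R[i].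
  by apply: Gamma_neq0; rewrite /= ltr_wpDl// mulr_ge0.
rewrite /Kc /ek /mlcoef; field.
rewrite G3 !Gamma_neq0// !pochhammer_neq0// Bint_neq0//.
by rewrite pnatr_eq0 -lt0n fact_gt0.
Qed.

Lemma wright_hatE N : ccvg_series (wright_term (upper N) (lower N) p) /\
  wright_hat (upper N) (lower N) p = Kc N * I N.
Proof.
apply: cseriesP => e e0.
have nK := normc_ge0 (Kc N).
have eK : 0 < e / (normc (Kc N) + 1) by rewrite divr_gt0// ltr_wpDl.
have := inner_series N eK; apply: filterS => n.
rewrite ltr_pdivlMr ?ltr_wpDl// => hn.
under eq_bigr do rewrite wright_termE.
rewrite -big_distrr/= -mulrBr Normc.normcM; apply: le_lt_trans hn.
set X := normc (_ - _); have : 0 <= X by exact: normc_ge0.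
nra.
Qed.

Let integrand t := w t * (F alpha1 x1 t * F alpha2 x2 t * E t).

Variables (C1 q1 C2 q2 : R).
Hypotheses (C10 : 0 <= C1) (C20 : 0 <= C2) (q1b : 0 <= q1 < 1) (q2b : 0 <= q2 < 1).
Hypotheses (b1 : forall m, normc (binom_coef alpha1 x1 m) <= C1 * q1 ^+ m)
  (b2 : forall m, normc (binom_coef alpha2 x2 m) <= C2 * q2 ^+ m).

Lemma factors_measurable : cmeasurable D (fun t => F alpha1 x1 t * F alpha2 x2 t * E t).
Proof.
apply: cmeasurableM; last exact: ml_measurable.
by apply: cmeasurableM; exact: binom_measurable.
Qed.

Lemma integrand_integrable : cintegrable D integrand.
Proof.
apply: (weighted_integrable (M := gtail C1 q1 0 * gtail C2 q2 0 * gtail C q 0)).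
  exact: factors_measurable.
move=> t Dt; rewrite !Normc.normcM.
have h1 : normc (F alpha1 x1 t) <= gtail C1 q1 0.
  by have := binom_tail 0 Dt hx1 C10 q1b b1; rewrite big_ord0 subr0.
have h2 : normc (F alpha2 x2 t) <= gtail C2 q2 0.
  by have := binom_tail 0 Dt hx2 C20 q2b b2; rewrite big_ord0 subr0.
apply: ler_pM; rewrite ?mulr_ge0 ?normc_ge0 ?ml_bound//.
by apply: ler_pM; rewrite ?normc_ge0.
Qed.

(** The finite set required by the definition is a square [square n]: for every
    larger [B] the error is at most a constant times the bound of
    [product_sum_dist]. *)
Lemma double_series :
  has_csum (fun x : nat * nat => (Bint alpha beta)^-1 *
      (binom_coef alpha1 x1 x.1 * binom_coef alpha2 x2 x.2 * I (x.1 + x.2)))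
    ((Bint alpha beta)^-1 * cintegral D integrand).
Proof.
move=> e e0.
pose nB := normc (Bint alpha beta)^-1.
have nB0 : 0 <= nB by exact: normc_ge0.
have G0 := gtail_ge0 0 C0 q01.
pose Z := nB * (2 * (2 * gtail C q 0 * H)) + 1.
have Z0 : 0 < Z.
  by apply: ltr_wpDl => //; apply: mulr_ge0 => //; do 2 apply: mulr_ge0 => //;
    apply: mulr_ge0.
have eZ : 0 < e / Z by rewrite divr_gt0.
have : (gtail C1 q1 0 * gtail C2 q2 n + gtail C1 q1 n * gtail C2 q2 0) @[n --> \oo] --> (0 : R).
  rewrite -[X in _ --> X]addr0; apply: cvgD.
    rewrite -[X in _ --> X](mulr0 (gtail C1 q1 0)); apply: cvgMr; exact: gtail_cvg0.
  rewrite -[X in _ --> X](mul0r (gtail C2 q2 0)); apply: cvgMl; exact: gtail_cvg0.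
move=> /cvgrPdist_lt /(_ _ eZ)[n _ /(_ n (leqnn n))].
rewrite sub0r normrN; set delta := _ + _.
have d0 : 0 <= delta by apply: addr_ge0; apply: mulr_ge0; exact: gtail_ge0.
rewrite ger0_norm// ltr_pdivlMr// => dZ.
exists [fset x in square n]%fset => B AB.
rewrite normr_normc ltcR.
have sB : {subset square n <= enum_fset B}.
  by move=> x xs; apply: (fsubsetP AB); rewrite inE.
rewrite -big_distrr/= -mulrBr Normc.normcM -/nB.
pose G (x : nat * nat) t :=
  w t * (binom_coef alpha1 x1 x.1 * binom_coef alpha2 x2 x.2 * (t%:C ^+ (x.1 + x.2) * E t)).
have iG x : cintegrable D (G x).
  have := cintegrableZ (binom_coef alpha1 x1 x.1 * binom_coef alpha2 x2 x.2) mD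
    (weighted_integrable (@tE_measurable (x.1 + x.2)%N)
      (fun t => @tE_bound (x.1 + x.2)%N t)).
  by apply: cintegrable_eq => // t _; rewrite /G mulrCA.
have GE x : binom_coef alpha1 x1 x.1 * binom_coef alpha2 x2 x.2 * I (x.1 + x.2) = cintegral D (G x).
  rewrite /I -cintegralZ//.
    by apply: eq_cintegral => t _; rewrite /G mulrCA.
  exact: (weighted_integrable (@tE_measurable (x.1 + x.2)%N)
      (fun t => @tE_bound (x.1 + x.2)%N t)).
under eq_bigr do rewrite GE.
rewrite normcB -cintegral_sum// -cintegralB//; last 2 first.
- exact: integrand_integrable.
- exact: cintegrable_sum.
pose g t := (F alpha1 x1 t * F alpha2 x2 t -
  \sum_(x <- enum_fset B) binom_term alpha1 x1 t x.1 * binom_term alpha2 x2 t x.2) * E t.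
rewrite (@eq_cintegral _ _ _ (fun t => w t * g t)); last first.
  move=> t _; rewrite /integrand /G /g -big_distrr/= -mulrBr; congr (_ * _).
  rewrite mulrBl big_distrl/=; congr (_ - _); apply: eq_bigr => x _.
  by rewrite /binom_term exprD; ring.
apply: (@le_lt_trans _ _ (nB * (2 * (2 * delta * gtail C q 0 * H)))).
  rewrite ler_wpM2l//; apply: weighted_bound.
    apply: cmeasurableM; last exact: ml_measurable.
    have m1 : cmeasurable D (fun t => F alpha1 x1 t * F alpha2 x2 t).
      by apply: cmeasurableM; exact: binom_measurable.
    have m2 : cmeasurable D (fun t => (-1) * \sum_(x <- enum_fset B)
        binom_term alpha1 x1 t x.1 * binom_term alpha2 x2 t x.2).
      apply: cmeasurableM; first exact: cmeasurable_cst.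
      apply: cmeasurable_sum => x; apply: cmeasurableM; apply: cmeasurableM;
        by [exact: cmeasurable_cst|exact: realX_measurable].
    by have := cmeasurableD m1 m2; apply: cmeasurable_eq => t _; rewrite mulN1r.
  move=> t Dt; rewrite /g Normc.normcM; apply: ler_pM; rewrite ?normc_ge0 ?ml_bound//.
  apply: product_sum_dist => //.
  - exact: binom_term_bound.
  - exact: binom_term_bound.
  - by move=> m; exact: binom_tail.
  - by move=> m; exact: binom_tail.
  - exact: fset_uniq.
apply: le_lt_trans dZ; rewrite /Z.
rewrite (_ : nB * _ = delta * (nB * (2 * (2 * gtail C q 0 * H)))); last by ring.
by apply: ler_wpM2l => //; rewrite lerDl.
Qed.

End WithBounds.
End TermwiseIntegration.

Theorem theorem1 (R : realType)
    (alpha beta alpha1 alpha2 x1 x2 p : R[i]) (lambda : R)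
    (halpha : 0 < complex.Re alpha) (hbeta : 0 < complex.Re beta) (hlambda : 0 <= lambda)
    (hx1 : `|x1| < 1) (hx2 : `|x2| < 1)
    (hp : lambda = 0 -> `|p| < 4) :
  let integrand := fun t : R =>
    cpow t%:C (alpha - 1) * cpow (1 - t%:C) (beta - 1) *
    cpow (1 - x1 * t%:C) (- alpha1) * cpow (1 - x2 * t%:C) (- alpha2) *
    mittag_leffler lambda (p * t%:C * (1 - t%:C)) in
  let upper := fun m n : nat =>
    [:: (alpha + (m + n)%:R, 1); (beta, 1); (1, 1)] : seq (R[i] * R) in
  let lower := fun m n : nat =>
    [:: (alpha + beta + (m + n)%:R, 2); (1, lambda)] : seq (R[i] * R) in
  [/\ cintegrable `]0, 1[ integrand,
      forall m n : nat, ccvg_series (wright_term (upper m n) (lower m n) p)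
    & has_csum
        (fun mn : nat * nat =>
           let: (m, n) := mn in
           pochhammer alpha (m + n) * pochhammer alpha1 m *
             pochhammer alpha2 n * x1 ^+ m * x2 ^+ n /
           (pochhammer (alpha + beta) (m + n) * m`!%:R * n`!%:R) *
           wright_hat (upper m n) (lower m n) p)
        ((Beta alpha beta)^-1 * cintegral `]0, 1[ integrand)].
Proof.
move=> integrand upper lower.
have nx1 : normc x1 < 1 by rewrite -ltcR -normr_normc.
have nx2 : normc x2 < 1 by rewrite -ltcR -normr_normc.
have np : lambda = 0 -> normc p < 4.
  move=> /hp; rewrite normr_normc (_ : 4 = (4 : R)%:C) ?ltcR//.
  by rewrite rmorph_nat.
have geom (x : R[i]) : normc x < 1 -> exists2 q : R, normc x < q & 0 <= q < 1.
  move=> x1'; have := normc_ge0 x.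
  by exists ((normc x + 1) / 2); [|apply/andP; split]; lra.
have [C [q [C0 q01 eC]]] := mlcoef_geometric hlambda np.
have [q1 xq1 q1b] := geom x1 nx1; have [q2 xq2 q2b] := geom x2 nx2.
have [C1 [/ltW C10 b1]] := binom_coef_geometric alpha1 xq1.
have [C2 [/ltW C20 b2]] := binom_coef_geometric alpha2 xq2.
have integrandE t : `]0, 1[%classic t -> betaf alpha beta t *
    (cpow (1 - x1 * t%:C) (- alpha1) * cpow (1 - x2 * t%:C) (- alpha2) *
     mittag_leffler lambda (p * t%:C * (1 - t%:C))) = integrand t.
  by rewrite /= in_itv/= => t01; rewrite /integrand betafE// !mulrA.
have W N := wright_hatE halpha hbeta hlambda C0 q01 eC N.
split.
- apply: (cintegrable_eq _ integrandE) => //.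
  exact: (integrand_integrable halpha hbeta nx1 nx2 C0 q01 eC C10 C20 q1b q2b b1 b2).
- by move=> m n; have [] := W (m + n)%N.
- rewrite BetaE// -(eq_cintegral integrandE).
  have := double_series halpha hbeta nx1 nx2 C0 q01 eC C10 C20 q1b q2b b1 b2.
  congr (has_csum _ _); apply/funext => -[m n].
  have [_ ->] := W (m + n)%N.
  have ab : 0 < Re (alpha + beta) by rewrite cReD addr_gt0.
  have p1 := pochhammer_neq0 (m + n) halpha.
  have p2 := pochhammer_neq0 (m + n) ab.
  have B0 := Bint_neq0 halpha hbeta.
  rewrite /binom_coef; field.
  by rewrite p1 p2 B0 !factC_neq0.
Qed.
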